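(* Let $A_{11},A_{22},A_{33}$, $B_{11},B_{22},B_{33}$ and $T_1$ be given matrices over $\mathbb{H}$ of sizes such that the equation $$A_{11}Y_{1}B_{11}+A_{22}Y_{2}B_{22}+A_{33}Y_{3}B_{33}=T_{1}\qquad(\star)$$ in the unknown quaternion matrices $Y_1,Y_2,Y_3$ makes sense, and let the auxiliary matrices be as in the context. Then the following statements are equivalent: (1) Equation $(\star)$ is consistent. (2) $R_{C_i}E_i=0$ and $E_iL_{D_i}=0$ for $i=1,2,3,4$, and $R_{E_{22}}EL_{E_{33}}=0$. (3) The following rank equalities hold: $$r(T_1,A_{11},A_{22},A_{33})=r(A_{11},A_{22},A_{33}),\qquad r\begin{pmatrix} T_1\\ B_{11}\\ B_{22}\\ B_{33}\end{pmatrix}=r\begin{pmatrix} B_{11}\\ B_{22}\\ B_{33}\end{pmatrix},$$ $$r\begin{pmatrix} T_1&A_{11}&A_{22}\\ B_{33}&0&0\end{pmatrix}=r(A_{11},A_{22})+r(B_{33}),\qquad r\begin{pmatrix} T_1&A_{11}&A_{33}\\ B_{22}&0&0\end{pmatrix}=r(A_{11},A_{33})+r(B_{22}),$$ $$r\begin{pmatrix} T_1&A_{33}&A_{22}\\ B_{11}&0&0\end{pmatrix}=r(A_{33},A_{22})+r(B_{11}),\qquad r\begin{pmatrix} T_1&A_{33}\\ B_{11}&0\\ B_{22}&0\end{pmatrix}=r\begin{pmatrix} B_{11}\\ B_{22}\end{pmatrix}+r(A_{33}),$$ $$r\begin{pmatrix} T_1&0&A_{11}&0&A_{33}\\ 0&-T_1&0&A_{22}&A_{33}\\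 B_{22}&0&0&0&0\\ 0&B_{11}&0&0&0\\ B_{33}&B_{33}&0&0&0\end{pmatrix}=r\begin{pmatrix} B_{22}&0\\ 0&B_{11}\\ B_{33}&B_{33}\end{pmatrix}+r\begin{pmatrix} A_{11}&0&A_{33}\\ 0&A_{22}&A_{33}\end{pmatrix},$$ $$r\begin{pmatrix} T_1&A_{22}\\ B_{11}&0\\ B_{33}&0\end{pmatrix}=r\begin{pmatrix} B_{11}\\ B_{33}\end{pmatrix}+r(A_{22}),\qquad r\begin{pmatrix} T_1&A_{11}\\ B_{33}&0\\ B_{22}&0\end{pmatrix}=r\begin{pmatrix} B_{33}\\ B_{22}\end{pmatrix}+r(A_{11}).$$ In this case, the general solution to $(\star)$ can be expressed as $$Y_1=A_{11}^\dagger TB_{11}^\dagger-A_{11}^\dagger A_{22}M_1^\dagger TB_{11}^\dagger-A_{11}^\dagger S_1A_{22}^\dagger TN_1^\dagger B_{22}B_{11}^\dagger-A_{11}^\dagger S_1U_4R_{N_1}B_{22}B_{11}^\dagger+L_{A_{11}}U_5+U_6R_{B_{11}},$$ $$Y_2=M_1^\dagger TB_{22}^\dagger+S_1^\dagger S_1A_{22}^\dagger TN_1^\dagger+L_{M_1}L_{S_1}U_7+U_8R_{B_{22}}+L_{M_1}U_4R_{N_1},$$ $$Y_3=F_1+L_{C_2}V_1+V_2R_{D_1}+L_{C_1}V_3R_{D_2},\quad\text{or}\quad Y_3=F_2-L_{C_4}W_1-W_2R_{D_3}-L_{C_3}W_3R_{D_4},$$ where $T=T_1-A_{33}Y_3B_{33}$,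 $U_4,\dots,U_8$ are arbitrary matrices of suitable sizes over $\mathbb{H}$, and $$V_1=(I_m,\,0)\left[C_{11}^\dagger(F-C_{22}V_3D_{22}-C_{33}W_3D_{33})-C_{11}^\dagger U_{11}D_{11}+L_{C_{11}}U_{12}\right],$$ $$W_1=(0,\,I_m)\left[C_{11}^\dagger(F-C_{22}V_3D_{22}-C_{33}W_3D_{33})-C_{11}^\dagger U_{11}D_{11}+L_{C_{11}}U_{12}\right],$$ $$W_2=\left[R_{C_{11}}(F-C_{22}V_3D_{22}-C_{33}W_3D_{33})D_{11}^\dagger+C_{11}C_{11}^\dagger U_{11}+U_{21}R_{D_{11}}\right]\begin{pmatrix} 0\\ I_n\end{pmatrix},$$ $$V_2=\left[R_{C_{11}}(F-C_{22}V_3D_{22}-C_{33}W_3D_{33})D_{11}^\dagger+C_{11}C_{11}^\dagger U_{11}+U_{21}R_{D_{11}}\right]\begin{pmatrix} I_n\\ 0\end{pmatrix},$$ $$V_3=E_{11}^\dagger FE_{33}^\dagger-E_{11}^\dagger E_{22}M^\dagger FE_{33}^\dagger-E_{11}^\dagger SE_{22}^\dagger FN^\dagger E_{44}E_{33}^\dagger-E_{11}^\dagger SU_{31}R_NE_{44}E_{33}^\dagger+L_{E_{11}}U_{32}+U_{33}R_{E_{33}},$$ $$W_3=M^\dagger FE_{44}^\dagger+S^\dagger SE_{22}^\dagger FN^\dagger+L_ML_SU_{41}+L_MU_{31}R_N-U_{42}R_{E_{44}},$$ with $U_{11},U_{12},U_{21},U_{31},U_{32},U_{33},U_{41},U_{42}$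 arbitrary matrices of suitable sizes over $\mathbb{H}$, $m$ the number of columns of $A_{33}$ and $n$ the number of rows of $B_{33}$.
   Context: ''The general solution can be expressed as'' means: for every choice of the arbitrary matrices the resulting tuple is a solution, and every solution arises from some such choice. $\mathbb{H}$ is the Hamilton quaternion algebra over $\mathbb{R}$. For a quaternion matrix $A$, $A^*$ is its conjugate transpose, $r(A)$ its rank, and $A^\dagger$ its Moore--Penrose inverse, i.e. the unique $Y$ with $AYA=A$, $YAY=Y$, $(AY)^*=AY$, $(YA)^*=YA$. Put $L_A=I-A^\dagger A$ and $R_A=I-AA^\dagger$. $I$ (or $I_k$) and $0$ denote identity and zero matrices of appropriate sizes; $(P,Q)$ denotes the block row matrix. Definitions, given $A_{11},A_{22},A_{33},B_{11},B_{22},B_{33},T_1$: $M_1=R_{A_{11}}A_{22}$, $N_1=B_{22}L_{B_{11}}$, $S_1=A_{22}L_{M_1}$; $C=R_{M_1}R_{A_{11}}$, $C_1=CA_{33}$, $C_2=R_{A_{11}}A_{33}$, $C_3=R_{A_{22}}A_{33}$, $C_4=A_{33}$; $D=L_{B_{11}}L_{N_1}$, $D_1=B_{33}$, $D_2=B_{33}L_{B_{22}}$, $D_3=B_{33}L_{B_{11}}$, $D_4=B_{33}D$; $E_1=CT_1$, $E_2=R_{A_{11}}T_1L_{B_{22}}$, $E_3=R_{A_{22}}T_1L_{B_{11}}$, $E_4=T_1D$; $C_{11}=(L_{C_2},\,L_{C_4})$, $D_{11}=\begin{pmatrix} R_{D_1}\\ R_{D_3}\end{pmatrix}$, $C_{22}=L_{C_1}$,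 $D_{22}=R_{D_2}$, $C_{33}=L_{C_3}$, $D_{33}=R_{D_4}$; $E_{11}=R_{C_{11}}C_{22}$, $E_{22}=R_{C_{11}}C_{33}$, $E_{33}=D_{22}L_{D_{11}}$, $E_{44}=D_{33}L_{D_{11}}$, $M=R_{E_{11}}E_{22}$, $N=E_{44}L_{E_{33}}$, $S=E_{22}L_M$; $F_1=C_1^\dagger E_1D_1^\dagger+L_{C_1}C_2^\dagger E_2D_2^\dagger$, $F_2=C_3^\dagger E_3D_3^\dagger+L_{C_3}C_4^\dagger E_4D_4^\dagger$, $F=F_2-F_1$, $E=R_{C_{11}}FL_{D_{11}}$. *)

(* Defs.v *)
From HB Require Import structures.
From mathcomp Require Import all_boot all_order all_algebra.
From mathcomp Require Import ring.
From mathcomp Require Import boolp classical_sets reals.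

Set Implicit Arguments.
Unset Strict Implicit.
Unset Printing Implicit Defensive.

Import GRing.Theory.
Local Open Scope ring_scope.

(* [Quaternion a b c d] is a + b i + c j + d k. *)
Record quaternion (R : realType) : Type :=
  Quaternion { qre : R; qi : R; qj : R; qk : R }.

Section QuaternionRing.
Variable R : realType.
Implicit Types x y z : quaternion R.

Definition tuple_of_quaternion x : R * R * R * R :=
  (qre x, qi x, qj x, qk x).
Definition quaternion_of_tuple (t : R * R * R * R) : quaternion R :=
  let: (a, b, c, d) := t in Quaternion a b c d.

Lemma tuple_of_quaternionK : cancel tuple_of_quaternion quaternion_of_tuple.
Proof. by case. Qed.

HB.instance Definition _ :=
  Equality.copy (quaternion R) (can_type tuple_of_quaternionK).
HB.instance Definition _ :=
  Choice.copy (quaternion R) (can_type tuple_of_quaternionK).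

Definition addq x y : quaternion R :=
  Quaternion (qre x + qre y) (qi x + qi y) (qj x + qj y) (qk x + qk y).
Definition oppq x : quaternion R :=
  Quaternion (- qre x) (- qi x) (- qj x) (- qk x).
Definition zeroq : quaternion R := Quaternion 0 0 0 0.
Definition oneq : quaternion R := Quaternion 1 0 0 0.
Definition mulq x y : quaternion R :=
  Quaternion
    (qre x * qre y - qi x * qi y - qj x * qj y - qk x * qk y)
    (qre x * qi y + qi x * qre y + qj x * qk y - qk x * qj y)
    (qre x * qj y - qi x * qk y + qj x * qre y + qk x * qi y)
    (qre x * qk y + qi x * qj y - qj x * qi y + qk x * qre y).
Definition conjq x : quaternion R :=
  Quaternion (qre x) (- qi x) (- qj x) (- qk x).

Lemma addqA : associative addq.
Proof. by move=> [????] [????] [????]; congr Quaternion => /=; ring. Qed.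
Lemma addqC : commutative addq.
Proof. by move=> [????] [????]; congr Quaternion => /=; ring. Qed.
Lemma add0q : left_id zeroq addq.
Proof. by move=> [????]; congr Quaternion => /=; ring. Qed.
Lemma addNq : left_inverse zeroq oppq addq.
Proof. by move=> [????]; congr Quaternion => /=; ring. Qed.

HB.instance Definition _ :=
  GRing.isZmodule.Build (quaternion R) addqA addqC add0q addNq.

Lemma mulqA : associative mulq.
Proof. by move=> [????] [????] [????]; congr Quaternion => /=; ring. Qed.
Lemma mul1q : left_id oneq mulq.
Proof. by move=> [????]; congr Quaternion => /=; ring. Qed.
Lemma mulq1 : right_id oneq mulq.
Proof. by move=> [????]; congr Quaternion => /=; ring. Qed.
Lemma mulqDl : left_distributive mulq addq.
Proof. by move=> [????] [????] [????]; congr Quaternion => /=; ring. Qed.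
Lemma mulqDr : right_distributive mulq addq.
Proof. by move=> [????] [????] [????]; congr Quaternion => /=; ring. Qed.
Lemma oneq_neq0 : oneq != zeroq.
Proof. by apply/eqP => -[] /eqP; rewrite oner_eq0. Qed.

HB.instance Definition _ :=
  GRing.Zmodule_isNzRing.Build (quaternion R)
    mulqA mul1q mulq1 mulqDl mulqDr oneq_neq0.

End QuaternionRing.

Section QuaternionMatrix.
Variable R : realType.

Definition conjtrmx m n (A : 'M[quaternion R]_(m, n)) :
    'M[quaternion R]_(n, m) :=
  (map_mx (@conjq R) A)^T.

(* Scalars act on columns from the right, as in [A *m x]. *)
Definition columns_free m n (A : 'M[quaternion R]_(m, n)) (J : {set 'I_n}) :
    Prop :=
  forall x : 'cV[quaternion R]_n,
    (forall j, j \notin J -> x j 0 = 0) -> A *m x = 0 -> x = 0.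

(* The rank is the maximal number of right linearly independent columns; the
   library's [mxrank] requires commutative scalars. *)
Definition qrank m n (A : 'M[quaternion R]_(m, n)) : nat :=
  \max_(J : {set 'I_n} | `[< columns_free A J >]) #|J|.

Definition is_mpinv m n (A : 'M[quaternion R]_(m, n))
    (Y : 'M[quaternion R]_(n, m)) : Prop :=
  [/\ A *m Y *m A = A, Y *m A *m Y = Y,
      conjtrmx (A *m Y) = A *m Y & conjtrmx (Y *m A) = Y *m A].

(* Exactly one [Y] satisfies [is_mpinv A Y]; the default [0] is never used. *)
Definition mpinv m n (A : 'M[quaternion R]_(m, n)) : 'M[quaternion R]_(n, m) :=
  xget 0 [set Y | is_mpinv A Y]%classic.

Definition L_ m n (A : 'M[quaternion R]_(m, n)) : 'M[quaternion R]_n :=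
  1%:M - mpinv A *m A.

Definition R_ m n (A : 'M[quaternion R]_(m, n)) : 'M[quaternion R]_m :=
  1%:M - A *m mpinv A.

End QuaternionMatrix.

Notation "A ^†" := (mpinv A) (at level 1, format "A ^†") : ring_scope.

(* Main.v *)
(** For fixed [Y3] the equation is a two-term equation in [Y1] and [Y2], whose
    four solvability conditions read [Ci Y3 Di = Ei].  The first two of these
    form a nested pair (each of [C1], [D2] is a multiple of [C2], [D1]), and so
    do the last two; each pair has an explicit general solution.  Equating both
    expressions for [Y3] leaves, after projecting with [R_ C11] and [L_ D11],
    the two-term equation [E11 V3 E33 + E22 W3 E44 = E].  Three of its four
    solvability conditions hold automatically, since [E] factors through [E11]
    on the left and through [E44] on the right; the fourth one is
    [R_ E22 E L_ E33 = 0].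

    The rank conditions follow from
    [r (T, A; B, 0) = r A + r B + r (R_ A T L_ B)] and from comparing left and
    right annihilators of block matrices with the given projections. *)

From HB Require Import structures.
Require Import Defs.
From mathcomp Require Import all_boot all_order all_algebra.
From mathcomp Require Import ring boolp reals.
From mathcomp Require classical_sets.

Set Implicit Arguments.
Unset Strict Implicit.
Unset Printing Implicit Defensive.

Import Order.TTheory GRing.Theory Num.Theory.
Local Open Scope ring_scope.

(** * Equations over a ring with Moore-Penrose inverses *)

(** The equations use two facts only: [A^†] is an inner inverse, and it absorbs [R_ B] (or [L_ B])
    on one side whenever [A] does on the other. Absorption is where orthogonality of the projections
    enters. It makes [M^† T] depend on [R_ A T] alone, and it is why [V3] and [W3] can be written
    with [F] although their equation has right-hand side [E].

    Completeness never inverts the formulas: a given solution is split by complementary projections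
    such as [A^† A] and [L_ A], and the pieces serve as parameters.

    The four reduced equations form a square: 1-2, 3-4, 1-3 and 2-4 are nested, while 2 and 3 are
    not linked directly. The edges 1-2 and 3-4 give the two families for [Y3]; the edges 1-3 and 2-4
    bring in the compatibilities that make [E] factor.

    Since quaternions do not commute, ranks and pseudo-inverses rest on the real part of the trace.
    Its positivity on [conjtrmx A *m A] gives Moore-Penrose inverses; together with cyclicity it
    shows that all full-rank factorizations have the same inner size. *)

(* Only the properties of the Moore-Penrose inverse listed here matter for the
   equations. *)
Section Equations.
Variable K : pzRingType.
Local Notation "''H_' ( m , n )" := 'M[K]_(m, n) (format "''H_' ( m ,  n )").
Variable mp : forall m n, 'H_(m, n) -> 'H_(n, m).
Variable Lp : forall m n, 'H_(m, n) -> 'H_(n, n).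
Variable Rp : forall m n, 'H_(m, n) -> 'H_(m, m).
Local Notation "A ^†" := (mp A) : ring_scope.
Local Notation L_ := Lp.
Local Notation R_ := Rp.
Hypothesis mpinvK : forall m n (A : 'H_(m, n)), A *m A^† *m A = A.
Hypothesis L_def : forall m n (A : 'H_(m, n)), L_ A = 1%:M - A^† *m A.
Hypothesis R_def : forall m n (A : 'H_(m, n)), R_ A = 1%:M - A *m A^†.
Hypothesis mpinv_R : forall m n p (A : 'H_(m, n)) (B : 'H_(m, p)),
  R_ B *m A = A -> A^† *m R_ B = A^†.
Hypothesis L_mpinv : forall m n p (A : 'H_(m, n)) (B : 'H_(p, n)),
  A *m L_ B = A -> L_ B *m A^† = A^†.

(** * Identities for the projections [L_] and [R_] *)

(** Products are kept associated to the left, so a known product [X *m Y] is usually not a subterm;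
    this form rewrites it behind any prefix [u]. *)
Lemma mulmx_rw k m n p (X : 'H_(m, n)) (Y : 'H_(n, p)) Z (u : 'H_(k, m)) :
  X *m Y = Z -> u *m X *m Y = u *m Z.
Proof. by rewrite -mulmxA => ->. Qed.

Lemma mulmx_projl k m n (A : 'H_(m, n)) (B : 'H_(k, m)) :
  B *m A *m A^† *m A = B *m A.
Proof. by rewrite -!mulmxA [A *m _]mulmxA mpinvK. Qed.

Lemma mulmx_L k m n (A : 'H_(m, n)) (u : 'H_(k, n)) :
  u *m L_ A = u - u *m A^† *m A.
Proof. by rewrite L_def mulmxBr mulmx1 mulmxA. Qed.

Lemma L_mulmx k m n (A : 'H_(m, n)) (x : 'H_(n, k)) :
  L_ A *m x = x - A^† *m A *m x.
Proof. by rewrite L_def mulmxBl mul1mx. Qed.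

Lemma mulmx_R k m n (A : 'H_(m, n)) (u : 'H_(k, m)) :
  u *m R_ A = u - u *m A *m A^†.
Proof. by rewrite R_def mulmxBr mulmx1 mulmxA. Qed.

Lemma R_mulmx k m n (A : 'H_(m, n)) (x : 'H_(m, k)) :
  R_ A *m x = x - A *m A^† *m x.
Proof. by rewrite R_def mulmxBl mul1mx. Qed.

Lemma R_mul m n (A : 'H_(m, n)) : R_ A *m A = 0.
Proof. by rewrite R_mulmx mpinvK subrr. Qed.

Lemma mul_L m n (A : 'H_(m, n)) : A *m L_ A = 0.
Proof. by rewrite mulmx_L mpinvK subrr. Qed.

Lemma mul_R_id m n (A : 'H_(m, n)) k (u : 'H_(k, m)) :
  u *m A = 0 -> u *m R_ A = u.
Proof. by move=> uA; rewrite mulmx_R uA mul0mx subr0. Qed.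

Lemma L_mul_id m n (A : 'H_(m, n)) k (x : 'H_(n, k)) :
  A *m x = 0 -> L_ A *m x = x.
Proof. by move=> Ax; rewrite L_mulmx -mulmxA Ax mulmx0 subr0. Qed.

Lemma R_idem m n (A : 'H_(m, n)) : R_ A *m R_ A = R_ A.
Proof. exact/mul_R_id/R_mul. Qed.

Lemma L_idem m n (A : 'H_(m, n)) : L_ A *m L_ A = L_ A.
Proof. exact/L_mul_id/mul_L. Qed.

Lemma R_mul_eq0 m n (A : 'H_(m, n)) k (x : 'H_(m, k)) :
  R_ A *m x = 0 -> A *m A^† *m x = x.
Proof. by rewrite R_mulmx => /subr0_eq. Qed.

Lemma mul_L_eq0 m n (A : 'H_(m, n)) k (u : 'H_(k, n)) :
  u *m L_ A = 0 -> u *m A^† *m A = u.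
Proof. by rewrite mulmx_L => /subr0_eq. Qed.

Lemma mulmx_split_R k m n (A : 'H_(m, n)) (u : 'H_(k, m)) :
  u *m A *m A^† + u *m R_ A = u.
Proof. by rewrite mulmx_R addrC subrK. Qed.

Lemma mulmx_split_L k m n (A : 'H_(m, n)) (u : 'H_(n, k)) :
  A^† *m A *m u + L_ A *m u = u.
Proof. by rewrite L_mulmx addrC subrK. Qed.

(** * The two-term equation [A X B + A' Y B' = T] *)

Section TwoTerms.
Variables m n p q r s : nat.
Variables (A : 'H_(m, p)) (B : 'H_(q, n)) (A' : 'H_(m, r)) (B' : 'H_(s, n)).
Variables (M : 'H_(m, r)) (N : 'H_(s, n)) (S : 'H_(m, r)).

(** [M], [N] and [S] stay free here, so that one formula serves for [Y1] and for [V3]. *)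
Definition two_term_X (T : 'H_(m, n)) (U4 : 'H_(r, s)) (U5 U6 : 'H_(p, q)) :=
  A^† *m T *m B^† - A^† *m A' *m M^† *m T *m B^†
  - A^† *m S *m A'^† *m T *m N^† *m B' *m B^†
  - A^† *m S *m U4 *m R_ N *m B' *m B^† + L_ A *m U5 + U6 *m R_ B.

Definition two_term_Y (T : 'H_(m, n)) (U4 U7 U8 : 'H_(r, s)) :=
  M^† *m T *m B'^† + S^† *m S *m A'^† *m T *m N^†
  + L_ M *m L_ S *m U7 + U8 *m R_ B' + L_ M *m U4 *m R_ N.

Hypothesis ME : M = R_ A *m A'.
Hypothesis NE : N = B' *m L_ B.
Hypothesis SE : S = A' *m L_ M.

(** For the two-term equation, the symmetry conditions of the Moore-Penrose inverse enter through
    this lemma and the next two. *)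
Lemma mpinv_M_R : M^† *m R_ A = M^†.
Proof. by apply: mpinv_R; rewrite ME mulmxA R_idem. Qed.

Lemma L_mpinv_N : L_ B *m N^† = N^†.
Proof. by apply: L_mpinv; rewrite NE -mulmxA L_idem. Qed.

Lemma L_mpinv_S : L_ M *m S^† = S^†.
Proof. by apply: L_mpinv; rewrite SE -mulmxA L_idem. Qed.

Lemma S_sub : S = A' - A' *m M^† *m M.
Proof. by rewrite SE mulmx_L. Qed.

(** [M] ends in [A'], so [S = A' - A' M^† M] is a left multiple of [A']. *)
Lemma S_projl : S *m A'^† *m A' = S.
Proof.
rewrite S_sub (mulmxBl A') (mulmxBl (A' *m _)) mpinvK.
by rewrite ME !mulmxA mulmx_projl.
Qed.

Lemma A'_mpinv_S : A' *m S^† *m S = S.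
Proof. by rewrite -{1}L_mpinv_S mulmxA -SE mpinvK. Qed.

Lemma R_mul_S : R_ A *m S = 0.
Proof. by rewrite SE mulmxA -ME mul_L. Qed.

(** The terms in [U7] and [U8] die because [A' L_ M = S] and [S L_ S = 0], respectively
    [R_ B' B' = 0]. The hypothesis makes [B'^† B'] act trivially after [M^† T = M^† R_ A T]. *)
Lemma two_term_Y_mul T U4 U7 U8 : R_ A *m T *m L_ B' = 0 ->
  A' *m two_term_Y T U4 U7 U8 *m B' =
  A' *m M^† *m T + S *m A'^† *m T *m N^† *m B' + S *m U4 *m R_ N *m B'.
Proof.
move=> RTL; rewrite /two_term_Y.
have MT : A' *m M^† *m T *m B'^† *m B' = A' *m M^† *m T.
  by rewrite -(mulmx_rw A' mpinv_M_R) -!(mulmxA (A' *m M^†)) (mul_L_eq0 RTL).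
rewrite !(mulmxDr A') !(mulmxDl _ _ B') !mulmxA MT A'_mpinv_S -SE mul_L.
by rewrite !mul0mx addr0 (mulmx_rw _ (R_mul B')) mulmx0 addr0.
Qed.

(** The first four summands of [two_term_X] expand [A^† (T - A' Y B') B^†]; thus [X] is the general
    solution of [A X B = T - A' Y B'] for the [Y] already chosen. [U7] and [U8] may be anything, as
    they cancel in [A' Y B']. *)
Lemma two_term_XE T U4 U5 U6 U7 U8 : R_ A *m T *m L_ B' = 0 ->
  two_term_X T U4 U5 U6 =
  A^† *m (T - A' *m two_term_Y T U4 U7 U8 *m B') *m B^†
  + L_ A *m U5 + U6 *m R_ B.
Proof.
move=> RTL; rewrite two_term_Y_mul // /two_term_X; congr (_ + _ + _).
rewrite (mulmxBr A^†) (mulmxBl (_ *m T)) !(mulmxDr A^†) !(mulmxDl _ _ B^†).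
by rewrite !opprD !addrA !mulmxA.
Qed.

(** With [Z = A' Y B'], the equation [A X B = T - Z] is solvable once [R_ A] and [L_ B] kill
    [T - Z]. Both follow from the expansion of [Z]: [R_ A S = 0] leaves [M M^† R_ A T], and
    [S + A' M^† M = A'] recombines the two terms of [Z L_ B]. *)
Lemma two_term_sound T U4 U5 U6 U7 U8 :
  R_ M *m (R_ A *m T) = 0 -> R_ A *m T *m L_ B' = 0 ->
  R_ A' *m (T *m L_ B) = 0 -> T *m L_ B *m L_ N = 0 ->
  A *m two_term_X T U4 U5 U6 *m B + A' *m two_term_Y T U4 U7 U8 *m B' = T.
Proof.
move=> RT RTL RTL' TL; rewrite (two_term_XE U4 U5 U6 U7 U8 RTL).
set Z := A' *m _ *m B'.
have ZE : Z = A' *m M^† *m T + S *m A'^† *m T *m N^† *m B'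
              + S *m U4 *m R_ N *m B' by exact: two_term_Y_mul.
have RZ : R_ A *m Z = R_ A *m T.
  rewrite ZE !(mulmxDr (R_ A)) !mulmxA R_mul_S !mul0mx !addr0 -ME.
  by rewrite -(mulmx_rw _ mpinv_M_R) -mulmxA (R_mul_eq0 RT).
have ZL : Z *m L_ B = T *m L_ B.
  have TN : T *m N^† *m N = T *m L_ B.
    by rewrite -{1}L_mpinv_N mulmxA (mul_L_eq0 TL).
  rewrite ZE !(mulmxDl _ _ (L_ B)) -!(mulmxA _ B') -NE.
  rewrite (mulmx_rw _ (R_mul N)) mulmx0 addr0.
  rewrite -!(mulmxA _ T) -(mulmxA _ _ N) TN S_sub.
  rewrite (mulmxBl A') (mulmxBl (A' *m _)) (R_mul_eq0 RTL').
  have -> : A' *m M^† *m M *m A'^† *m (T *m L_ B) = A' *m M^† *m (T *m L_ B).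
    rewrite {2}ME -!(mulmxA (A' *m M^†)) -!(mulmxA (R_ A)).
    by rewrite (R_mul_eq0 RTL') [LHS]mulmxA (mulmx_rw _ mpinv_M_R).
  by rewrite addrC subrK.
have RTZ : R_ A *m (T - Z) = 0 by rewrite (mulmxBr (R_ A)) RZ subrr.
have TZL : (T - Z) *m L_ B = 0 by rewrite (mulmxBl T) ZL subrr.
rewrite !(mulmxDr A) !(mulmxDl _ _ B) !mulmxA mul_L !mul0mx addr0.
rewrite (mulmx_rw _ (R_mul B)) mulmx0 addr0.
by rewrite (R_mul_eq0 RTZ) (mul_L_eq0 TZL) subrK.
Qed.

Lemma two_term_necessary X Y (T : 'H_(m, n)) :
  A *m X *m B + A' *m Y *m B' = T ->
  [/\ R_ M *m (R_ A *m T) = 0, R_ A *m T *m L_ B' = 0,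
      R_ A' *m (T *m L_ B) = 0 & T *m L_ B *m L_ N = 0].
Proof.
move=> <-; split.
- rewrite !(mulmxDr (R_ _)) !mulmxA (mulmx_rw _ (R_mul A)) mulmx0 !mul0mx add0r.
  by rewrite -(mulmxA _ _ A') -ME R_mul !mul0mx.
- rewrite (mulmxDr (R_ _)) (mulmxDl _ _ (L_ _)) !mulmxA R_mul !mul0mx add0r.
  by rewrite (mulmx_rw _ (mul_L B')) mulmx0.
- rewrite (mulmxDl _ _ (L_ _)) (mulmxDr (R_ _)) !mulmxA R_mul !mul0mx addr0.
  by rewrite (mulmx_rw _ (mul_L B)) mulmx0.
- rewrite !(mulmxDl _ _ (L_ _)) (mulmx_rw _ (mul_L B)) mulmx0 mul0mx add0r.
  by rewrite -(mulmxA _ B') -NE (mulmx_rw _ (mul_L N)) mulmx0.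
Qed.

(** The solution itself supplies the parameters. As [L_ M L_ S = L_ M - S^† S], the [S] terms cancel
    and [two_term_Y] collapses to [M^† M Y + L_ M Y]. *)
Lemma two_term_complete X Y (T : 'H_(m, n)) : A *m X *m B + A' *m Y *m B' = T ->
  exists U4 U5 U6 U7 U8,
    X = two_term_X T U4 U5 U6 /\ Y = two_term_Y T U4 U7 U8.
Proof.
move=> TE; have [_ RTL _ _] := two_term_necessary TE.
have MT : M^† *m T = M^† *m M *m Y *m B'.
  rewrite -{1}mpinv_M_R -mulmxA -TE (mulmxDr (R_ _)) !mulmxA R_mul.
  by rewrite !mul0mx add0r ME !mulmxA.
have TN : T *m N^† = A' *m Y *m N *m N^†.
  rewrite -{1}L_mpinv_N mulmxA -TE (mulmxDl _ _ (L_ _)).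
  by rewrite (mulmx_rw _ (mul_L B)) mulmx0 add0r NE !mulmxA.
have SP : S^† *m S *m A'^† *m A' = S^† *m S.
  by rewrite -!mulmxA (mulmxA S) S_projl.
have YE : Y = two_term_Y T Y (Y *m N *m N^†) (M^† *m M *m Y).
  rewrite /two_term_Y MT (mulmx_rw _ TN) !mulmxA SP.
  rewrite mulmx_L L_mpinv_S !mulmxBl addrACA subrr addr0.
  by rewrite -addrA addrACA !mulmx_split_R mulmx_split_L.
exists Y, X, (A^† *m A *m X), (Y *m N *m N^†), (M^† *m M *m Y); split=> //.
rewrite (two_term_XE _ _ _ (Y *m N *m N^†) (M^† *m M *m Y) RTL) -YE.
have -> : T - A' *m Y *m B' = A *m X *m B by rewrite -TE addrK.
by rewrite !mulmxA addrAC mulmx_split_R mulmx_split_L.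
Qed.

End TwoTerms.

(** * Two equations [C1 Y D1 = E1], [C2 Y D2 = E2] with nested coefficients *)

Section NestedPair.
Variables m1 m2 p q n1 n2 : nat.
Variables (C1 : 'H_(m1, p)) (D1 : 'H_(q, n1)) (E1 : 'H_(m1, n1)).
Variables (C2 : 'H_(m2, p)) (D2 : 'H_(q, n2)) (E2 : 'H_(m2, n2)).
Variables (P : 'H_(m1, m2)) (Q : 'H_(n1, n2)).
Hypothesis C1E : C1 = P *m C2.
Hypothesis D2E : D2 = D1 *m Q.

(** The first summand solves equation 1; the second is killed by [C1] and repairs equation 2. *)
Definition nested_pair_particular :=
  C1^† *m E1 *m D1^† + L_ C1 *m C2^† *m E2 *m D2^†.

(** Compatibility [E1 Q = P E2] gives [E1 D1^† D2 = P E2]. In equation 2 the first summand then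
    contributes [C2 C1^† P E2], which the part [- C1^† C1] of [L_ C1] removes from the second. *)
Lemma nested_pair_particularP : E1 *m Q = P *m E2 ->
  R_ C1 *m E1 = 0 -> E1 *m L_ D1 = 0 -> R_ C2 *m E2 = 0 -> E2 *m L_ D2 = 0 ->
  C1 *m nested_pair_particular *m D1 = E1 /\
  C2 *m nested_pair_particular *m D2 = E2.
Proof.
move=> EQ RE1 EL1 RE2 EL2; rewrite /nested_pair_particular !mulmxDr !mulmxDl.
split; rewrite !mulmxA.
  by rewrite mul_L !mul0mx addr0 (R_mul_eq0 RE1) (mul_L_eq0 EL1).
have E1D : E1 *m D1^† *m D2 = P *m E2 by rewrite D2E mulmxA (mul_L_eq0 EL1).
rewrite -!(mulmxA (C2 *m C1^†)) E1D.
rewrite -(mulmxA _ E2) -(mulmxA _ _ D2) (mul_L_eq0 EL2).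
rewrite mulmx_L !mulmxBl (R_mul_eq0 RE2).
have -> : C2 *m C1^† *m C1 *m C2^† *m E2 = C2 *m C1^† *m (P *m E2).
  by rewrite {2}C1E -!(mulmxA (C2 *m C1^†)) -!(mulmxA P)
             (R_mul_eq0 RE2).
by rewrite addrC subrK.
Qed.

Lemma nested_pair_homogeneous V1 V2 V3 :
  let Y := L_ C2 *m V1 + V2 *m R_ D1 + L_ C1 *m V3 *m R_ D2 in
  C1 *m Y *m D1 = 0 /\ C2 *m Y *m D2 = 0.
Proof.
have CL : C1 *m L_ C2 = 0 by rewrite C1E -mulmxA mul_L mulmx0.
have RD : R_ D1 *m D2 = 0 by rewrite D2E mulmxA R_mul mul0mx.
move=> Y; rewrite /Y !mulmxDr !mulmxDl !mulmxA !mul_L CL !mul0mx.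
by rewrite (mulmx_rw _ RD) !(mulmx_rw _ (R_mul _)) !mulmx0 !addr0.
Qed.

(** After [L_ C2 Y] and [C2^† C2 Y R_ D1] are split off, the rest is [Z]. Nestedness gives
    [C1 Z = C1 Y D1 D1^† = 0] and [Z D2 = C2^† C2 Y D2 = 0], so [Z] already has the third form. *)
Lemma nested_pair_complete Y : C1 *m Y *m D1 = 0 -> C2 *m Y *m D2 = 0 ->
  exists V1 V2 V3, Y = L_ C2 *m V1 + V2 *m R_ D1 + L_ C1 *m V3 *m R_ D2.
Proof.
move=> Y1 Y2; pose Z := C2^† *m C2 *m Y *m D1 *m D1^†.
exists Y, (C2^† *m C2 *m Y), Z.
have -> : L_ C1 *m Z = Z.
  apply: L_mul_id; rewrite /Z C1E !mulmxA mulmx_projl -C1E.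
  by rewrite Y1 mul0mx.
have -> : Z *m R_ D2 = Z.
  apply: mul_R_id; rewrite /Z D2E !mulmxA mulmx_projl.
  by rewrite -(mulmxA _ D1) -D2E -!mulmxA (mulmxA C2) Y2 mulmx0.
by rewrite -addrA [X in _ + X]addrC mulmx_split_R addrC mulmx_split_L.
Qed.

End NestedPair.

(** * The equation [C X + Y D = G], and absorption in the two-term formulas *)

Lemma mixed_complete m n p q (C : 'H_(m, p)) (D : 'H_(q, n)) X Y G :
  C *m X + Y *m D = G ->
  exists U11 U12 U21,
    X = C^† *m G - C^† *m U11 *m D + L_ C *m U12 /\
    Y = R_ C *m G *m D^† + C *m C^† *m U11 + U21 *m R_ D.
Proof.
move=> <-; exists Y, X, (R_ C *m Y); split.
  by rewrite mulmxDr !mulmxA addrK mulmx_split_L.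
rewrite mulmxDr !mulmxA R_mul mul0mx add0r addrAC mulmx_split_R.
by rewrite R_mulmx subrK.
Qed.

Lemma mixed_sound m n p q (C : 'H_(m, p)) (D : 'H_(q, n)) U11 U12 U21 G :
  R_ C *m G *m L_ D = 0 ->
  C *m (C^† *m G - C^† *m U11 *m D + L_ C *m U12)
  + (R_ C *m G *m D^† + C *m C^† *m U11 + U21 *m R_ D) *m D = G.
Proof.
move=> RGL; rewrite mulmxDr mulmxBr !mulmxDl !mulmxA mul_L mul0mx addr0.
rewrite (mulmx_rw _ (R_mul D)) mulmx0 addr0 (mul_L_eq0 RGL).
by rewrite [X in _ + X]addrC addrA subrK R_mulmx addrC subrK.
Qed.

(** Every [T] in the formula stands between pseudo-inverses that absorb [P] and [Q]. This lets [F]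
    replace [E = R_ C11 F L_ D11]. *)
Lemma two_term_X_absorb m n p q r s (A : 'H_(m, p)) (B : 'H_(q, n))
    (A' : 'H_(m, r)) (B' : 'H_(s, n)) M N S (P : 'H_(m, m)) (Q : 'H_(n, n))
    T U4 U5 U6 :
  A^† *m P = A^† -> M^† *m P = M^† -> A'^† *m P = A'^† ->
  Q *m B^† = B^† -> Q *m N^† = N^† ->
  two_term_X A B A' B' M N S (P *m T *m Q) U4 U5 U6 =
  two_term_X A B A' B' M N S T U4 U5 U6.
Proof.
move=> AP MP A'P QB QN; rewrite /two_term_X !mulmxA AP.
by rewrite !(mulmx_rw _ MP) !(mulmx_rw _ A'P) !(mulmx_rw _ QB) !(mulmx_rw _ QN).
Qed.

Lemma two_term_Y_absorb m n r s (A' : 'H_(m, r)) (B' : 'H_(s, n)) M N S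
    (P : 'H_(m, m)) (Q : 'H_(n, n)) T U4 U7 U8 :
  M^† *m P = M^† -> A'^† *m P = A'^† ->
  Q *m B'^† = B'^† -> Q *m N^† = N^† ->
  two_term_Y A' B' M N S (P *m T *m Q) U4 U7 U8 =
  two_term_Y A' B' M N S T U4 U7 U8.
Proof.
move=> MP A'P QB QN; rewrite /two_term_Y !mulmxA MP.
by rewrite !(mulmx_rw _ A'P) !(mulmx_rw _ QB) !(mulmx_rw _ QN).
Qed.

(* Turns the equation for [(V1; W1)] and [(V2, W2)] into the equality of the two
   expressions for [Y3]. *)
Lemma zmod_transpose (V : zmodType) (f1 f2 s t u v w x : V) :
  s + t + (u + v) = f2 - f1 - w - x -> f1 + s + u + w = f2 - t - v - x.
Proof.
move=> /eqP; rewrite eq_sym !subr_eq => /eqP ->.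
apply/eqP; rewrite eq_sym !subr_eq.
by rewrite [X in X == _](AC (2*2*1*1*1) (7*1*3*6*5*4*2)).
Qed.

(** * The four equations [Ci Y Di = Ei] in one unknown *)

(* In the application [x], [y], [a], [b] are the projections [L_ B22], [L_ B11],
   [R_ A11], [R_ A22], while [c], [z] are the matrices [C], [D] of the
   statement. *)
Section Lattice.
Variables k l m n : nat.
Variables (C1 C2 C3 C4 : 'H_(k, m)) (D1 D2 D3 D4 : 'H_(n, l)).
Variables (E1 E2 E3 E4 : 'H_(k, l)).
Variables (a b c : 'H_(k, k)) (x y z : 'H_(l, l)).
Hypotheses (C2E : C2 = a *m C4) (C3E : C3 = b *m C4).
Hypotheses (C1E2 : C1 = c *m C2) (C1E3 : C1 = c *m C3).
Hypotheses (D2E : D2 = D1 *m x) (D3E : D3 = D1 *m y).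
Hypotheses (D4E2 : D4 = D2 *m z) (D4E3 : D4 = D3 *m z).
Hypotheses (E1x : E1 *m x = c *m E2) (E1y : E1 *m y = c *m E3).
Hypotheses (E2z : E2 *m z = a *m E4) (E3z : E3 *m z = b *m E4).
Variables (C11 : 'H_(m, m + m)) (D11 : 'H_(n + n, n)).
Variables (E11 E22 M S : 'H_(m, m)) (E33 E44 N : 'H_(n, n)).
Variables (F1 F2 F E : 'H_(m, n)).
Hypotheses (C11E : C11 = row_mx (L_ C2) (L_ C4)).
Hypotheses (D11E : D11 = col_mx (R_ D1) (R_ D3)).
Hypotheses (E11E : E11 = R_ C11 *m L_ C1) (E22E : E22 = R_ C11 *m L_ C3).
Hypotheses (E33E : E33 = R_ D2 *m L_ D11) (E44E : E44 = R_ D4 *m L_ D11).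
Hypotheses (ME : M = R_ E11 *m E22) (NE : N = E44 *m L_ E33).
Hypotheses (SE : S = E22 *m L_ M).
Hypotheses (F1E : F1 = nested_pair_particular C1 D1 E1 C2 D2 E2).
Hypotheses (F2E : F2 = nested_pair_particular C3 D3 E3 C4 D4 E4).
Hypotheses (FE : F = F2 - F1) (EE : E = R_ C11 *m F *m L_ D11).

Lemma R_C11_L2 : R_ C11 *m L_ C2 = 0.
Proof.
have := R_mul C11; rewrite {2}C11E mul_mx_row -[RHS]row_mx0.
by case/eq_row_mx.
Qed.

Lemma R3_L_D11 : R_ D3 *m L_ D11 = 0.
Proof.
have := mul_L D11; rewrite {1}D11E mul_col_mx -[RHS]col_mx0.
by case/eq_col_mx.
Qed.

Lemma E11_absorb : E11^† *m R_ C11 = E11^†.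
Proof. by apply: mpinv_R; rewrite E11E mulmxA R_idem. Qed.

Lemma E22_absorb : E22^† *m R_ C11 = E22^†.
Proof. by apply: mpinv_R; rewrite E22E mulmxA R_idem. Qed.

Lemma M_absorb : M^† *m R_ C11 = M^†.
Proof.
have E1R : R_ C11 *m E11 = E11 by rewrite E11E mulmxA R_idem.
have E2R : R_ C11 *m E22 = E22 by rewrite E22E mulmxA R_idem.
by apply: mpinv_R; rewrite ME (R_mulmx E11) mulmxBr E2R !mulmxA E1R.
Qed.

Lemma E33_absorb : L_ D11 *m E33^† = E33^†.
Proof. by apply: L_mpinv; rewrite E33E -mulmxA L_idem. Qed.

Lemma E44_absorb : L_ D11 *m E44^† = E44^†.
Proof. by apply: L_mpinv; rewrite E44E -mulmxA L_idem. Qed.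

Lemma N_absorb : L_ D11 *m N^† = N^†.
Proof.
have E3L : E33 *m L_ D11 = E33 by rewrite E33E -mulmxA L_idem.
have E4L : E44 *m L_ D11 = E44 by rewrite E44E -mulmxA L_idem.
by apply: L_mpinv; rewrite NE (mulmx_L E33) mulmxBl E4L (mulmx_rw _ E3L).
Qed.

(** The left side must vanish for the mixed equation in [(V1; W1)] and [(V2, W2)] to be solvable; so
    solvability is a two-term equation for [V3] and [W3]. *)
Lemma mixed_residual V3 W3 :
  R_ C11 *m (F - L_ C1 *m V3 *m R_ D2 - L_ C3 *m W3 *m R_ D4) *m L_ D11 =
  E - (E11 *m V3 *m E33 + E22 *m W3 *m E44).
Proof.
by rewrite !mulmxBr !mulmxBl -EE opprD addrA E11E E22E E33E E44E !mulmxA.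
Qed.

Definition equations (Y : 'H_(m, n)) :=
  [/\ C1 *m Y *m D1 = E1, C2 *m Y *m D2 = E2,
      C3 *m Y *m D3 = E3 & C4 *m Y *m D4 = E4].

Definition projections :=
  [/\ R_ C1 *m E1 = 0 /\ E1 *m L_ D1 = 0, R_ C2 *m E2 = 0 /\ E2 *m L_ D2 = 0,
      R_ C3 *m E3 = 0 /\ E3 *m L_ D3 = 0 & R_ C4 *m E4 = 0 /\ E4 *m L_ D4 = 0].

(** The link between equations 1 and 3 gives [C1 F2 = E1 D1^† D3 D3^†], while [C1 F1 = E1 D1^†].
    Hence [C1 F] is a multiple of [R_ D3], a block of [D11], and [L_ C1] fixes [F L_ D11]. *)
Lemma E_factor_left : projections -> E = E11 *m (F *m L_ D11).
Proof.
case=> [[RE1 EL1] [RE2 EL2] [RE3 EL3] [RE4 EL4]].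
have CF1 : C1 *m F1 = E1 *m D1^†.
  by rewrite F1E /nested_pair_particular mulmxDr !mulmxA mul_L !mul0mx addr0
             (R_mul_eq0 RE1).
have CF2 : C1 *m F2 = E1 *m D1^† *m D3 *m D3^†.
  rewrite F2E /nested_pair_particular {1}C1E3 -mulmxA mulmxDr !mulmxA mul_L.
  rewrite !mul0mx addr0 (R_mul_eq0 RE3) mulmxA -E1y {2}D3E !mulmxA.
  by rewrite (mul_L_eq0 EL1).
have CFL : C1 *m (F *m L_ D11) = 0.
  rewrite mulmxA FE mulmxBr CF1 CF2 -opprB -mulmx_R mulNmx.
  by rewrite (mulmx_rw _ R3_L_D11) mulmx0 oppr0.
by rewrite EE E11E -!mulmxA (L_mul_id CFL).
Qed.

(** The link between equations 2 and 4 turns [a E4] into [C2 C4^† E4]. Hence [F D4 = L_ C2 C4^† E4],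
    which [R_ C11] kills because [L_ C2] is a block of [C11]. *)
Lemma E_factor_right : projections -> E = R_ C11 *m F *m E44.
Proof.
case=> [[RE1 EL1] [RE2 EL2] [RE3 EL3] [RE4 EL4]].
have FD2 : F2 *m D4 = C4^† *m E4.
  rewrite F2E /nested_pair_particular mulmxDl {1}D4E3 !mulmxA.
  rewrite -(mulmxA _ E3) -(mulmxA _ _ D3) (mul_L_eq0 EL3).
  rewrite -(mulmxA _ E4) -(mulmxA _ _ D4) (mul_L_eq0 EL4).
  rewrite -(mulmxA _ E3) E3z L_mulmx mulmxBl {3}C3E -!mulmxA (mulmxA C4).
  by rewrite (R_mul_eq0 RE4) addrC subrK.
have FD1 : F1 *m D4 = C2^† *m (a *m E4).
  rewrite F1E /nested_pair_particular mulmxDl {2}D4E2 !mulmxA.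
  rewrite -(mulmxA _ E2) -(mulmxA _ _ D2) (mul_L_eq0 EL2).
  rewrite {1}D4E2 {1}D2E !mulmxA -(mulmxA _ E1) -(mulmxA _ _ D1).
  rewrite (mul_L_eq0 EL1) -(mulmxA _ E1) E1x.
  rewrite L_mulmx !mulmxBl {3}C1E2 -!mulmxA (mulmxA C2) (mulmxA (C2 *m _)).
  by rewrite (R_mul_eq0 RE2) E2z addrC subrK.
have RFD : R_ C11 *m F *m D4 = 0.
  rewrite -mulmxA FE mulmxBl FD1 FD2.
  rewrite -{2}(R_mul_eq0 RE4) (mulmxA a) (mulmxA a) -C2E -mulmxA mulmxA.
  by rewrite -L_mulmx mulmxA R_C11_L2 mul0mx.
by rewrite EE E44E mulmxA (mul_R_id RFD).
Qed.

Lemma lattice_residual_conditions :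
  projections -> R_ E22 *m E *m L_ E33 = 0 ->
  [/\ R_ M *m (R_ E11 *m E) = 0, R_ E11 *m E *m L_ E44 = 0,
      R_ E22 *m (E *m L_ E33) = 0 & E *m L_ E33 *m L_ N = 0].
Proof.
move=> proj REL; have EL := E_factor_left proj; have ER := E_factor_right proj.
have RE : R_ E11 *m E = 0 by rewrite EL mulmxA R_mul mul0mx.
split; rewrite ?RE ?mulmx0 ?mul0mx //.
  by rewrite mulmxA.
by rewrite ER -!mulmxA (mulmxA E44) -NE mul_L !mulmx0.
Qed.

Lemma equations_particular : projections ->
  [/\ C1 *m F1 *m D1 = E1, C2 *m F1 *m D2 = E2,
      C3 *m F2 *m D3 = E3 & C4 *m F2 *m D4 = E4].
Proof.
case=> [[RE1 EL1] [RE2 EL2] [RE3 EL3] [RE4 EL4]].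
have [] := nested_pair_particularP C1E2 D2E E1x RE1 EL1 RE2 EL2.
have [] := nested_pair_particularP C3E D4E3 E3z RE3 EL3 RE4 EL4.
by rewrite -F1E -F2E.
Qed.

(** Once both expressions are known to agree, the first yields equations 1 and 2 and the second
    yields equations 3 and 4. *)
Lemma equations_sound U11 U12 U21 U31 U32 U33 U41 U42 :
  projections -> R_ E22 *m E *m L_ E33 = 0 ->
  let V3 := two_term_X E11 E33 E22 E44 M N S F U31 U32 U33 in
  let W3 := two_term_Y E22 E44 M N S F U31 U41 U42 in
  let G := F - L_ C1 *m V3 *m R_ D2 - L_ C3 *m W3 *m R_ D4 in
  let V := C11^† *m G - C11^† *m U11 *m D11 + L_ C11 *m U12 in
  let W := R_ C11 *m G *m D11^† + C11 *m C11^† *m U11 + U21 *m R_ D11 in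
  let Y := F1 + L_ C2 *m (row_mx 1%:M 0 *m V)
           + W *m col_mx 1%:M 0 *m R_ D1 + L_ C1 *m V3 *m R_ D2 in
  Y = F2 - L_ C4 *m (row_mx 0 1%:M *m V)
      - W *m col_mx 0 1%:M *m R_ D3 - L_ C3 *m W3 *m R_ D4 /\ equations Y.
Proof.
move=> proj REL V3 W3 G V W Y.
have [cond1 cond2 cond3 cond4] := lattice_residual_conditions proj REL.
have := two_term_sound ME NE SE U31 U32 U33 U41 U42 cond1 cond2 cond3 cond4.
(* Unfolding [E] lets the pseudo-inverses absorb both projections; [E] then remains only as the
   right-hand side. *)
rewrite EE two_term_X_absorb ?two_term_Y_absorb;
  do ?[exact: E11_absorb | exact: M_absorb | exact: E22_absorb
      | exact: E33_absorb | exact: N_absorb | exact: E44_absorb].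
rewrite -EE -/V3 -/W3 => VW3.
have RGL : R_ C11 *m G *m L_ D11 = 0 by rewrite mixed_residual VW3 subrr.
have := mixed_sound U11 U12 U21 RGL; rewrite -/V -/W.
have -> : C11 *m V = L_ C2 *m (row_mx 1%:M 0 *m V)
                     + L_ C4 *m (row_mx 0 1%:M *m V).
  rewrite -[V]vsubmxK !mul_row_col !mul1mx !mul0mx addr0 add0r C11E.
  by rewrite mul_row_col.
have -> : W *m D11 = W *m col_mx 1%:M 0 *m R_ D1 + W *m col_mx 0 1%:M *m R_ D3.
  rewrite -[W]hsubmxK !mul_row_col !mulmx1 !mulmx0 addr0 add0r D11E.
  by rewrite mul_row_col.
rewrite /G FE => /zmod_transpose; rewrite -/Y => YE; split; first exact: YE.
have [Y1 Y2 Y3 Y4] := equations_particular proj.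
have [Z1 Z2] := nested_pair_homogeneous C1E2 D2E (row_mx 1%:M 0 *m V)
  (W *m col_mx 1%:M 0) V3.
have [Z3 Z4] := nested_pair_homogeneous C3E D4E3 (row_mx 0 1%:M *m V)
  (W *m col_mx 0 1%:M) W3.
split.
- by rewrite /Y -!addrA mulmxDr mulmxDl Y1 addrA Z1 addr0.
- by rewrite /Y -!addrA mulmxDr mulmxDl Y2 addrA Z2 addr0.
- by rewrite YE -!addrA -!opprD mulmxBr mulmxBl Y3 addrA Z3 subr0.
- by rewrite YE -!addrA -!opprD mulmxBr mulmxBl Y4 addrA Z4 subr0.
Qed.

(** [Y - F1] solves the homogeneous pair 1-2 and [F2 - Y] the pair 3-4; this orientation causes the
    minus signs in the second expression, and the two differences add up to [F]. *)
Lemma equations_residual Y : equations Y -> projections ->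
  exists V1 V2 V3 W1 W2 W3,
    [/\ Y = F1 + L_ C2 *m V1 + V2 *m R_ D1 + L_ C1 *m V3 *m R_ D2,
        Y = F2 - L_ C4 *m W1 - W2 *m R_ D3 - L_ C3 *m W3 *m R_ D4 &
        C11 *m col_mx V1 W1 + row_mx V2 W2 *m D11 =
        F - L_ C1 *m V3 *m R_ D2 - L_ C3 *m W3 *m R_ D4].
Proof.
case=> Y1 Y2 Y3 Y4 proj.
have [Z1 Z2 Z3 Z4] := equations_particular proj.
have [||V1 [V2 [V3 VE]]] := nested_pair_complete C1E2 D2E  (Y := Y - F1).
- by rewrite mulmxBr mulmxBl Y1 Z1 subrr.
- by rewrite mulmxBr mulmxBl Y2 Z2 subrr.
have [||W1 [W2 [W3 WE]]] := nested_pair_complete C3E D4E3  (Y := F2 - Y).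
- by rewrite mulmxBr mulmxBl Y3 Z3 subrr.
- by rewrite mulmxBr mulmxBl Y4 Z4 subrr.
exists V1, V2, V3, W1, W2, W3; split.
- by rewrite -[LHS](subrK F1) VE addrC !addrA.
- by rewrite -[LHS](subKr F2) WE !opprD !addrA.
rewrite C11E D11E !mul_row_col FE.
have -> : F2 - F1 = Y - F1 + (F2 - Y) by rewrite [RHS]addrC addrA subrK.
rewrite VE WE.
(* The permutation groups the [C11] terms and the [D11] terms and puts the [W3] and [V3] terms last,
   where they cancel. *)
by rewrite [X in _ = X - _ - _](AC (3*3) ((1*4)*(2*5)*6*3)) !addrK.
Qed.

Lemma equations_projections Y : equations Y -> projections.
Proof.
rewrite /projections => -[<- <- <- <-]; split; split;
by rewrite ?mulmxA ?R_mul ?mul0mx // -mulmxA mul_L mulmx0.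
Qed.

Lemma mixed_residual_eq V3 W3 X Z :
  C11 *m X + Z *m D11 = F - L_ C1 *m V3 *m R_ D2 - L_ C3 *m W3 *m R_ D4 ->
  E11 *m V3 *m E33 + E22 *m W3 *m E44 = E.
Proof.
move=> res; apply/esym/eqP; rewrite -subr_eq0 -mixed_residual -res mulmxDr.
by rewrite !mulmxA R_mul mul0mx add0r -mulmxA mul_L mulmx0.
Qed.

Lemma equations_projection Y : equations Y -> R_ E22 *m E *m L_ E33 = 0.
Proof.
move=> Yeq; have proj := equations_projections Yeq.
have [V1 [V2 [V3 [W1 [W2 [W3 [_ _ res]]]]]]] := equations_residual Yeq proj.
have [_ _ + _] := two_term_necessary ME NE (mixed_residual_eq res).
by rewrite mulmxA.
Qed.

(** Parameters are recovered from the inside out: the two-term equation yields those of [V3] and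
    [W3], then the mixed equation, with these fixed, yields [U11], [U12], [U21]. *)
Lemma equations_complete Y : equations Y ->
  exists U11 U12 U21 U31 U32 U33 U41 U42,
  let V3 := two_term_X E11 E33 E22 E44 M N S F U31 U32 U33 in
  let W3 := two_term_Y E22 E44 M N S F U31 U41 U42 in
  let G := F - L_ C1 *m V3 *m R_ D2 - L_ C3 *m W3 *m R_ D4 in
  let V := C11^† *m G - C11^† *m U11 *m D11 + L_ C11 *m U12 in
  let W := R_ C11 *m G *m D11^† + C11 *m C11^† *m U11 + U21 *m R_ D11 in
  Y = F1 + L_ C2 *m (row_mx 1%:M 0 *m V)
      + W *m col_mx 1%:M 0 *m R_ D1 + L_ C1 *m V3 *m R_ D2 /\
  Y = F2 - L_ C4 *m (row_mx 0 1%:M *m V)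
      - W *m col_mx 0 1%:M *m R_ D3 - L_ C3 *m W3 *m R_ D4.
Proof.
move=> Yeq; have proj := equations_projections Yeq.
have [V1 [V2 [V3 [W1 [W2 [W3 [YV YW res]]]]]]] := equations_residual Yeq proj.
have [U31 [U32 [U33 [U41 [U42]]]]] :=
  two_term_complete ME NE SE (mixed_residual_eq res).
rewrite EE two_term_X_absorb ?two_term_Y_absorb;
  do ?[exact: E11_absorb | exact: M_absorb | exact: E22_absorb
      | exact: E33_absorb | exact: N_absorb | exact: E44_absorb].
case=> V3E W3E.
have [U11 [U12 [U21 [VE WE]]]] := mixed_complete res.
exists U11, U12, U21, U31, U32, U33, U41, U42.
rewrite /= -V3E -W3E -VE -WE !mul_row_col !mul1mx !mul0mx addr0 add0r.
by rewrite !mulmx1 !mulmx0 addr0 add0r.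
Qed.

End Lattice.

(** * Annihilators of block matrices *)

(** The hypotheses give [P R_ A = P] and [R_ A P = R_ A]: the two matrices are left multiples of
    each other, hence kill the same [T]. *)
Lemma annihilator_left m n p (T : 'H_(m, n)) (A : 'H_(m, p)) (P : 'H_(m, m)) :
  P *m A = 0 -> R_ A *m P = R_ A -> R_ A *m T = 0 <-> P *m T = 0.
Proof.
move=> PA RP; split=> TE.
  by rewrite -(mul_R_id PA) -mulmxA TE mulmx0.
by rewrite -RP -mulmxA TE mulmx0.
Qed.

Lemma annihilator_right m n q (T : 'H_(m, n)) (B : 'H_(q, n)) (Q : 'H_(n, n)) :
  B *m Q = 0 -> Q *m L_ B = L_ B -> T *m L_ B = 0 <-> T *m Q = 0.
Proof.
move=> BQ QL; split=> TE.
  by rewrite -(L_mul_id BQ) mulmxA TE mul0mx.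
by rewrite -QL mulmxA TE mul0mx.
Qed.

Lemma R_row_mx m p1 p2 (A : 'H_(m, p1)) (B : 'H_(m, p2)) :
  R_ (row_mx A B) *m A = 0 /\ R_ (row_mx A B) *m B = 0.
Proof.
by have := R_mul (row_mx A B); rewrite mul_mx_row -[RHS]row_mx0 => /eq_row_mx.
Qed.

Lemma L_col_mx n q1 q2 (A : 'H_(q1, n)) (B : 'H_(q2, n)) :
  A *m L_ (col_mx A B) = 0 /\ B *m L_ (col_mx A B) = 0.
Proof.
by have := mul_L (col_mx A B); rewrite mul_col_mx -[RHS]col_mx0 => /eq_col_mx.
Qed.

(** * Reduction of the three-term equation, and its block conditions *)

Section ThreeTerms.
Variables p q a1 a2 m b1 b2 n : nat.
Variables (A11 : 'H_(p, a1)) (A22 : 'H_(p, a2)) (A33 : 'H_(p, m)).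
Variables (B11 : 'H_(b1, q)) (B22 : 'H_(b2, q)) (B33 : 'H_(n, q)).
Variable T1 : 'H_(p, q).
Variables (M1 : 'H_(p, a2)) (N1 : 'H_(b2, q)) (C : 'H_(p, p)) (D : 'H_(q, q)).
Variables (C1 C2 C3 : 'H_(p, m)) (D2 D3 D4 : 'H_(n, q)).
Variables (E1 E2 E3 E4 : 'H_(p, q)).
Hypotheses (M1E : M1 = R_ A11 *m A22) (N1E : N1 = B22 *m L_ B11).
Hypotheses (CE : C = R_ M1 *m R_ A11) (DE : D = L_ B11 *m L_ N1).
Hypotheses (C1E : C1 = C *m A33) (C2E : C2 = R_ A11 *m A33).
Hypotheses (C3E : C3 = R_ A22 *m A33) (D2E : D2 = B33 *m L_ B22).
Hypotheses (D3E : D3 = B33 *m L_ B11) (D4E : D4 = B33 *m D).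
Hypotheses (E1E : E1 = C *m T1) (E2E : E2 = R_ A11 *m T1 *m L_ B22).
Hypotheses (E3E : E3 = R_ A22 *m T1 *m L_ B11) (E4E : E4 = T1 *m D).

Lemma C_A11 : C *m A11 = 0. Proof. by rewrite CE -mulmxA R_mul mulmx0. Qed.

Lemma C_A22 : C *m A22 = 0. Proof. by rewrite CE -mulmxA -M1E R_mul. Qed.

Lemma B11_D : B11 *m D = 0. Proof. by rewrite DE mulmxA mul_L mul0mx. Qed.

Lemma B22_D : B22 *m D = 0. Proof. by rewrite DE mulmxA -N1E mul_L. Qed.

(** With [C_A11] and [C_A22], this identifies the rows fixed by [C] as those killing [A11] and
    [A22], so [C] can stand in for [R_ (row_mx A11 A22)]. *)
Lemma mul_C_id h (u : 'H_(h, p)) : u *m A11 = 0 -> u *m A22 = 0 -> u *m C = u.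
Proof.
move=> uA1 uA2; have uM : u *m M1 = 0 by rewrite M1E mulmxA (mul_R_id uA1).
by rewrite CE mulmxA (mul_R_id uM) (mul_R_id uA1).
Qed.

Lemma D_mul_id h (x : 'H_(q, h)) : B11 *m x = 0 -> B22 *m x = 0 -> D *m x = x.
Proof.
move=> xB1 xB2; have xN : N1 *m x = 0 by rewrite N1E -mulmxA (L_mul_id xB1).
by rewrite DE -mulmxA (L_mul_id xN) (L_mul_id xB1).
Qed.

Lemma C1_C2 : C1 = C *m C2.
Proof. by rewrite C1E C2E mulmxA (mul_R_id C_A11). Qed.

Lemma C1_C3 : C1 = C *m C3.
Proof. by rewrite C1E C3E mulmxA (mul_R_id C_A22). Qed.

Lemma D4_D2 : D4 = D2 *m D.
Proof. by rewrite D4E D2E -mulmxA (L_mul_id B22_D). Qed.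

Lemma D4_D3 : D4 = D3 *m D.
Proof. by rewrite D4E D3E -mulmxA (L_mul_id B11_D). Qed.

Lemma E1_E2 : E1 *m L_ B22 = C *m E2.
Proof. by rewrite E1E E2E !mulmxA (mul_R_id C_A11). Qed.

Lemma E1_E3 : E1 *m L_ B11 = C *m E3.
Proof. by rewrite E1E E3E !mulmxA (mul_R_id C_A22). Qed.

Lemma E2_E4 : E2 *m D = R_ A11 *m E4.
Proof. by rewrite E2E E4E -!mulmxA (L_mul_id B22_D). Qed.

Lemma E3_E4 : E3 *m D = R_ A22 *m E4.
Proof. by rewrite E3E E4E -!mulmxA (L_mul_id B11_D). Qed.

Lemma reduced_conditions Y :
  let T := T1 - A33 *m Y *m B33 in
  [/\ R_ M1 *m (R_ A11 *m T) = 0, R_ A11 *m T *m L_ B22 = 0,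
      R_ A22 *m (T *m L_ B11) = 0 & T *m L_ B11 *m L_ N1 = 0] <->
  equations C1 C2 C3 A33 B33 D2 D3 D4 E1 E2 E3 E4 Y.
Proof.
move=> T; rewrite /T /equations.
have -> : R_ M1 *m (R_ A11 *m (T1 - A33 *m Y *m B33)) = E1 - C1 *m Y *m B33.
  by rewrite C1E E1E CE !mulmxBr !mulmxA.
have -> : R_ A11 *m (T1 - A33 *m Y *m B33) *m L_ B22 = E2 - C2 *m Y *m D2.
  by rewrite C2E D2E E2E mulmxBr mulmxBl !mulmxA.
have -> : R_ A22 *m ((T1 - A33 *m Y *m B33) *m L_ B11) = E3 - C3 *m Y *m D3.
  by rewrite C3E D3E E3E mulmxBl mulmxBr !mulmxA.
have -> : (T1 - A33 *m Y *m B33) *m L_ B11 *m L_ N1 = E4 - A33 *m Y *m D4.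
  by rewrite D4E E4E DE !mulmxBl !mulmxA.
by split=> -[e1 e2 e3 e4]; split;
  first [exact/esym/subr0_eq | apply/eqP; rewrite subr_eq0; exact/eqP/esym].
Qed.

(* The numbering of the block conditions is that of the rank conditions of the
   theorem. *)
Lemma block_condition1 :
  R_ (row_mx A11 (row_mx A22 A33)) *m T1 = 0 <-> R_ C1 *m E1 = 0.
Proof.
rewrite E1E mulmxA; apply: annihilator_left.
  rewrite !mul_mx_row -!(mulmxA (R_ C1)) C_A11 C_A22 -C1E R_mul !mulmx0.
  by rewrite !row_mx0.
have [R1] := R_row_mx A11 (row_mx A22 A33).
rewrite mul_mx_row -[RHS]row_mx0 => /eq_row_mx [R2 R3].
set P := R_ (row_mx _ _) in R1 R2 R3 *; have PC := mul_C_id R1 R2.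
have PC1 : P *m C1 = 0 by rewrite C1E mulmxA PC.
by rewrite mulmxA (mul_R_id PC1).
Qed.

Lemma block_condition2 :
  T1 *m L_ (col_mx B11 (col_mx B22 B33)) = 0 <-> E4 *m L_ D4 = 0.
Proof.
rewrite E4E -mulmxA; apply: annihilator_right.
  by rewrite !mul_col_mx !mulmxA B11_D B22_D -D4E mul_L !mul0mx !col_mx0.
have [L1] := L_col_mx B11 (col_mx B22 B33).
rewrite mul_col_mx -[RHS]col_mx0 => /eq_col_mx [L2 L3].
set P := L_ (col_mx _ _) in L1 L2 L3 *; have DP := D_mul_id L1 L2.
have D4P : D4 *m P = 0 by rewrite D4E -mulmxA DP.
by rewrite -mulmxA (L_mul_id D4P).
Qed.

Lemma block_condition3 :
  R_ (row_mx A11 A22) *m T1 *m L_ B33 = 0 <-> E1 *m L_ B33 = 0.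
Proof.
rewrite E1E -!mulmxA; apply: annihilator_left.
  by rewrite mul_mx_row C_A11 C_A22 row_mx0.
by have [R1 R2] := R_row_mx A11 A22; exact: mul_C_id.
Qed.

(** [R_ C2 *m R_ A11] kills [A11] and, since [C2 = R_ A11 *m A33], also [A33]; rows with this
    property are fixed by it. Such two-stage projections recur in the neighbouring conditions. *)
Lemma block_condition4 :
  R_ (row_mx A11 A33) *m T1 *m L_ B22 = 0 <-> R_ C2 *m E2 = 0.
Proof.
rewrite E2E -(mulmxA (R_ A11)) mulmxA -mulmxA; apply: annihilator_left.
  by rewrite mul_mx_row -!mulmxA -C2E !R_mul mulmx0 row_mx0.
have [R1 R2] := R_row_mx A11 A33; set P := R_ (row_mx _ _) in R1 R2 *.
have PC2 : P *m C2 = 0 by rewrite C2E mulmxA (mul_R_id R1).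
by rewrite mulmxA (mul_R_id PC2) (mul_R_id R1).
Qed.

Lemma block_condition5 :
  R_ (row_mx A33 A22) *m T1 *m L_ B11 = 0 <-> R_ C3 *m E3 = 0.
Proof.
rewrite E3E -(mulmxA (R_ A22)) mulmxA -mulmxA; apply: annihilator_left.
  by rewrite mul_mx_row -!mulmxA -C3E !R_mul mulmx0 row_mx0.
have [R1 R2] := R_row_mx A33 A22; set P := R_ (row_mx _ _) in R1 R2 *.
have PC3 : P *m C3 = 0 by rewrite C3E mulmxA (mul_R_id R2).
by rewrite mulmxA (mul_R_id PC3) (mul_R_id R2).
Qed.

Lemma block_condition6 :
  R_ A33 *m T1 *m L_ (col_mx B11 B22) = 0 <-> R_ A33 *m E4 = 0.
Proof.
rewrite E4E mulmxA; apply: annihilator_right.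
  by rewrite mul_col_mx B11_D B22_D col_mx0.
by have [L1 L2] := L_col_mx B11 B22; exact: D_mul_id.
Qed.

Lemma block_condition8 :
  R_ A22 *m T1 *m L_ (col_mx B11 B33) = 0 <-> E3 *m L_ D3 = 0.
Proof.
rewrite E3E -(mulmxA (R_ A22 *m T1)); apply: annihilator_right.
  by rewrite mul_col_mx !mulmxA -D3E !mul_L mul0mx col_mx0.
have [L1 L2] := L_col_mx B11 B33; set P := L_ (col_mx _ _) in L1 L2 *.
have D3P : D3 *m P = 0 by rewrite D3E -mulmxA (L_mul_id L1).
by rewrite -mulmxA (L_mul_id D3P) (L_mul_id L1).
Qed.

Lemma block_condition9 :
  R_ A11 *m T1 *m L_ (col_mx B33 B22) = 0 <-> E2 *m L_ D2 = 0.
Proof.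
rewrite E2E -(mulmxA (R_ A11 *m T1)); apply: annihilator_right.
  by rewrite mul_col_mx !mulmxA -D2E !mul_L mul0mx col_mx0.
have [L1 L2] := L_col_mx B33 B22; set P := L_ (col_mx _ _) in L1 L2 *.
have D2P : D2 *m P = 0 by rewrite D2E -mulmxA (L_mul_id L2).
by rewrite -mulmxA (L_mul_id D2P) (L_mul_id L2).
Qed.

Definition block_conditions :=
  R_ (row_mx A11 (row_mx A22 A33)) *m T1 = 0 /\
  T1 *m L_ (col_mx B11 (col_mx B22 B33)) = 0 /\
  R_ (row_mx A11 A22) *m T1 *m L_ B33 = 0 /\
  R_ (row_mx A11 A33) *m T1 *m L_ B22 = 0 /\
  R_ (row_mx A33 A22) *m T1 *m L_ B11 = 0 /\
  R_ A33 *m T1 *m L_ (col_mx B11 B22) = 0 /\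
  R_ (col_mx (row_mx A11 (row_mx 0 A33)) (row_mx 0 (row_mx A22 A33)))
    *m col_mx (row_mx T1 0) (row_mx 0 (- T1))
    *m L_ (col_mx (row_mx B22 0) (col_mx (row_mx 0 B11) (row_mx B33 B33))) = 0
  /\ R_ A22 *m T1 *m L_ (col_mx B11 B33) = 0
  /\ R_ A11 *m T1 *m L_ (col_mx B33 B22) = 0.

(** * The block condition with two copies of [T1] *)

Section BlockCondition7.
Variables (C11 : 'H_(m, m + m)) (D11 : 'H_(n + n, n)).
Variables (E22 : 'H_(m, m)) (E33 : 'H_(n, n)) (F1 F2 F E : 'H_(m, n)).
Hypotheses (C11E : C11 = row_mx (L_ C2) (L_ A33)).
Hypotheses (D11E : D11 = col_mx (R_ B33) (R_ D3)).
Hypotheses (E22E : E22 = R_ C11 *m L_ C3) (E33E : E33 = R_ D2 *m L_ D11).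
Hypotheses (F1P : C2 *m F1 *m D2 = E2) (F2P : C3 *m F2 *m D3 = E3).
Hypotheses (FE : F = F2 - F1) (EE : E = R_ C11 *m F *m L_ D11).

(* Rows [u A33 = - v A33] and columns [B33 x = - B33 y] are those fixed by
   [R_ E22 R_ C11] and [L_ D11 L_ E33], so [F] vanishes on them iff
   [R_ E22 E L_ E33 = 0]. *)
Lemma bilinear_F h g (u v : 'H_(h, p)) (x y : 'H_(q, g)) :
  u *m A11 = 0 -> v *m A22 = 0 -> u *m A33 = - (v *m A33) ->
  B22 *m x = 0 -> B11 *m y = 0 -> B33 *m x = - (B33 *m y) ->
  u *m A33 *m F *m (B33 *m x) = v *m T1 *m y - u *m T1 *m x.
Proof.
move=> uA vA uvA xB yB xyB; rewrite FE mulmxBr mulmxBl; congr (_ - _).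
  rewrite uvA xyB mulmxN !mulNmx opprK.
  rewrite -{1}(mul_R_id vA) -{1}(L_mul_id yB) -(mulmxA v) -C3E.
  rewrite (mulmxA B33) -D3E.
  rewrite -!mulmxA (mulmxA F2) (mulmxA C3) (mulmxA C3) F2P E3E.
  by rewrite -!mulmxA (L_mul_id yB) mulmxA (mul_R_id vA).
rewrite -{1}(mul_R_id uA) -{1}(L_mul_id xB) -(mulmxA u) -C2E (mulmxA B33) -D2E.
rewrite -!mulmxA (mulmxA F1) (mulmxA C2) (mulmxA C2) F1P E2E.
by rewrite -!mulmxA (L_mul_id xB) mulmxA (mul_R_id uA).
Qed.

(** The block product pairs rows [(u, v)] killing [A] with columns [(x; y)] killed by [B]. The entry
    [- T1] makes this pairing a difference, which [bilinear_F] identifies, up to sign, with [F]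
    between [u A33] and [B33 x]. *)
Lemma block_condition7 :
  R_ (col_mx (row_mx A11 (row_mx 0 A33)) (row_mx 0 (row_mx A22 A33)))
  *m col_mx (row_mx T1 0) (row_mx 0 (- T1))
  *m L_ (col_mx (row_mx B22 0) (col_mx (row_mx 0 B11) (row_mx B33 B33))) = 0
  <-> R_ E22 *m E *m L_ E33 = 0.
Proof.
set A := col_mx _ (row_mx 0 (row_mx A22 _)); set T := col_mx _ (row_mx 0 (- _)).
set B := col_mx (row_mx B22 _) _.
have bilinearE h g (u v : 'H_(h, p)) (x y : 'H_(q, g)) :
    row_mx u v *m T *m col_mx x y = u *m T1 *m x - v *m T1 *m y.
  rewrite mul_row_col !mul_mx_row add_row_mx !mulmx0 addr0 add0r mul_row_col.
  by rewrite mulmxN mulNmx.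
have RE : R_ E22 *m E *m L_ E33 = R_ E22 *m R_ C11 *m F *m (L_ D11 *m L_ E33).
  by rewrite EE !mulmxA.
split=> [RTL|REL].
  rewrite RE; set w := R_ E22 *m R_ C11; set z := L_ D11 *m L_ E33.
  have [w2 _] : w *m L_ C2 = 0 /\ w *m L_ A33 = 0.
    apply: eq_row_mx; rewrite -mul_mx_row -C11E -mulmxA R_mul mulmx0.
    by rewrite row_mx0.
  have w3 : w *m L_ C3 = 0 by rewrite -mulmxA -E22E R_mul.
  have [_ z3] : R_ B33 *m z = 0 /\ R_ D3 *m z = 0.
    apply: eq_col_mx; rewrite -mul_col_mx -D11E mulmxA mul_L mul0mx.
    by rewrite col_mx0.
  have z2 : R_ D2 *m z = 0 by rewrite mulmxA -E33E mul_L.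
  (* These lift [w] through [A33] and [z] through [B33]: [w L_ C2 = 0] means [w = w C2^† C2], and
     [C2 = R_ A11 A33]. The signs in [v] and [y] make the shared third blocks cancel. *)
  pose u := w *m C2^† *m R_ A11; pose v := - (w *m C3^† *m R_ A22).
  pose x := L_ B22 *m (D2^† *m z); pose y := - (L_ B11 *m (D3^† *m z)).
  have uA : u *m A11 = 0 by rewrite -mulmxA R_mul mulmx0.
  have vA : v *m A22 = 0 by rewrite mulNmx -mulmxA R_mul mulmx0 oppr0.
  have uA3 : u *m A33 = w by rewrite -mulmxA -C2E (mul_L_eq0 w2).
  have vA3 : v *m A33 = - w by rewrite mulNmx -mulmxA -C3E (mul_L_eq0 w3).
  have xB : B22 *m x = 0 by rewrite mulmxA mul_L mul0mx.
  have yB : B11 *m y = 0 by rewrite mulmxN mulmxA mul_L mul0mx oppr0.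
  have xB3 : B33 *m x = z by rewrite mulmxA -D2E mulmxA (R_mul_eq0 z2).
  have yB3 : B33 *m y = - z.
    by rewrite mulmxN mulmxA -D3E mulmxA (R_mul_eq0 z3).
  have uvA : row_mx u v *m A = 0.
    rewrite mul_row_col !mul_mx_row !add_row_mx uA vA uA3 vA3 !mulmx0 !addr0.
    by rewrite subrr !row_mx0.
  have xyB : B *m col_mx x y = 0.
    rewrite !mul_col_mx !mul_row_col xB yB xB3 yB3 !mul0mx !addr0 subrr.
    by rewrite !col_mx0.
  rewrite -uA3 -xB3 (@bilinear_F _ _ u v x y) ?vA3 ?yB3 ?opprK //.
  apply/eqP; rewrite -oppr_eq0 opprB -bilinearE.
  rewrite -(mul_R_id uvA) -(L_mul_id xyB) -!mulmxA (mulmxA T).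
  by rewrite (mulmxA (R_ A)) (mulmxA (R_ A)) RTL mul0mx mulmx0.
(* Conversely, the halves of [R_ A] and [L_ B] are used as [u], [v], [x], [y]. *)
have := R_mul A; have := mul_L B.
rewrite -[R_ A]hsubmxK -[L_ B]vsubmxK bilinearE.
move: (lsubmx _) (rsubmx _) (usubmx _) (dsubmx _) => u v x y.
rewrite !mul_col_mx !mul_row_col !mul0mx addr0 add0r.
rewrite -[RHS]col_mx0 => /eq_col_mx [xB]; rewrite -[RHS]col_mx0.
move=> /eq_col_mx [yB xyB].
rewrite !mul_mx_row !mulmx0 !add_row_mx addr0 add0r.
rewrite -[RHS]row_mx0 => /eq_row_mx [uA]; rewrite -[RHS]row_mx0.
move=> /eq_row_mx [vA uvA].
have uA3 : u *m A33 = - (v *m A33) by apply/eqP; rewrite -addr_eq0 uvA.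
have xB3 : B33 *m x = - (B33 *m y) by apply/eqP; rewrite -addr_eq0 xyB.
apply/eqP; rewrite -oppr_eq0 opprB -(bilinear_F uA vA uA3 xB yB xB3).
set w := u *m A33; set z := B33 *m x.
have wC : w *m C11 = 0.
  rewrite C11E mul_mx_row /w -(mulmxA u A33 (L_ A33)) mul_L mulmx0.
  by rewrite -(mul_R_id uA) -(mulmxA u) -C2E -mulmxA mul_L mulmx0 row_mx0.
have wE : w *m E22 = 0.
  rewrite E22E mulmxA (mul_R_id wC) /w uA3 -(mul_R_id vA) -(mulmxA v) -C3E.
  by rewrite mulNmx -mulmxA mul_L mulmx0 oppr0.
have zD : D11 *m z = 0.
  rewrite D11E mul_col_mx /z mulmxA R_mul mul0mx xB3 -(L_mul_id yB).
  by rewrite (mulmxA B33) -D3E mulmxN mulmxA R_mul mul0mx oppr0 col_mx0.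
have zE : E33 *m z = 0.
  rewrite E33E -mulmxA (L_mul_id zD) /z -(L_mul_id xB) (mulmxA B33) -D2E.
  by rewrite mulmxA R_mul mul0mx.
rewrite -(mul_R_id wC) -(L_mul_id zD) -(mul_R_id wE) -(L_mul_id zE).
rewrite -!mulmxA.
have -> : R_ E22 *m (R_ C11 *m (F *m (L_ D11 *m (L_ E33 *m z)))) =
  R_ E22 *m E *m L_ E33 *m z by rewrite RE !mulmxA.
by rewrite REL mul0mx !mulmx0.
Qed.

End BlockCondition7.

(** * Consistency and the general solution *)

Section Solutions.
Variables (S1 : 'H_(p, a2)) (C11 : 'H_(m, m + m)) (D11 : 'H_(n + n, n)).
Variables (E11 E22 M S : 'H_(m, m)) (E33 E44 N : 'H_(n, n)).
Variables (F1 F2 F E : 'H_(m, n)).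
Hypotheses (S1E : S1 = A22 *m L_ M1).
Hypotheses (C11E : C11 = row_mx (L_ C2) (L_ A33)).
Hypotheses (D11E : D11 = col_mx (R_ B33) (R_ D3)).
Hypotheses (E11E : E11 = R_ C11 *m L_ C1) (E22E : E22 = R_ C11 *m L_ C3).
Hypotheses (E33E : E33 = R_ D2 *m L_ D11) (E44E : E44 = R_ D4 *m L_ D11).
Hypotheses (ME : M = R_ E11 *m E22) (NE : N = E44 *m L_ E33).
Hypotheses (SE : S = E22 *m L_ M).
Hypotheses (F1E : F1 = C1^† *m E1 *m B33^† + L_ C1 *m C2^† *m E2 *m D2^†).
Hypotheses (F2E : F2 = C3^† *m E3 *m D3^† + L_ C3 *m A33^† *m E4 *m D4^†).
Hypotheses (FE : F = F2 - F1) (EE : E = R_ C11 *m F *m L_ D11).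

Definition solution Y1 Y2 Y3 :=
  A11 *m Y1 *m B11 + A22 *m Y2 *m B22 + A33 *m Y3 *m B33 = T1.

Definition projection_conditions :=
  [/\ R_ C1 *m E1 = 0 /\ E1 *m L_ B33 = 0, R_ C2 *m E2 = 0 /\ E2 *m L_ D2 = 0,
      R_ C3 *m E3 = 0 /\ E3 *m L_ D3 = 0, R_ A33 *m E4 = 0 /\ E4 *m L_ D4 = 0
    & R_ E22 *m E *m L_ E33 = 0].

(** [W3] is spelled out because it differs from [two_term_Y] in the order of its terms and the sign
    of [U42]. [Y3'] is separate so that equality of the two expressions becomes a claim. *)
Definition general_solution U4 U5 U6 U7 U8 U11 U12 U21 U31 U32 U33 U41 U42
    Y1 Y2 Y3 Y3' :=
  let V3 := two_term_X E11 E33 E22 E44 M N S F U31 U32 U33 in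
  let W3 := M^† *m F *m E44^† + S^† *m S *m E22^† *m F *m N^†
            + L_ M *m L_ S *m U41 + L_ M *m U31 *m R_ N
            - U42 *m R_ E44 in
  let G := F - L_ C1 *m V3 *m R_ D2 - L_ C3 *m W3 *m R_ D4 in
  let V := C11^† *m G - C11^† *m U11 *m D11 + L_ C11 *m U12 in
  let W := R_ C11 *m G *m D11^† + C11 *m C11^† *m U11 + U21 *m R_ D11 in
  let T := T1 - A33 *m Y3 *m B33 in
  [/\ Y1 = two_term_X A11 B11 A22 B22 M1 N1 S1 T U4 U5 U6,
      Y2 = two_term_Y A22 B22 M1 N1 S1 T U4 U7 U8,
      Y3 = F1 + L_ C2 *m (row_mx 1%:M 0 *m V) + W *m col_mx 1%:M 0 *m R_ B33
           + L_ C1 *m V3 *m R_ D2 &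
      Y3' = F2 - L_ A33 *m (row_mx 0 1%:M *m V) - W *m col_mx 0 1%:M *m R_ D3
            - L_ C3 *m W3 *m R_ D4].

Lemma solution_two_term Y1 Y2 Y3 : solution Y1 Y2 Y3 <->
  A11 *m Y1 *m B11 + A22 *m Y2 *m B22 = T1 - A33 *m Y3 *m B33.
Proof. by split=> [<-|YE]; rewrite /solution ?addrK // YE subrK. Qed.

Lemma solution_equations Y1 Y2 Y3 : solution Y1 Y2 Y3 ->
  equations C1 C2 C3 A33 B33 D2 D3 D4 E1 E2 E3 E4 Y3.
Proof.
by move/solution_two_term/(two_term_necessary M1E N1E) => ?;
  exact/reduced_conditions.
Qed.

Lemma general_solution_sound U4 U5 U6 U7 U8 U11 U12 U21 U31 U32 U33 U41 U42
    Y1 Y2 Y3 Y3' : projection_conditions ->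
  general_solution U4 U5 U6 U7 U8 U11 U12 U21 U31 U32 U33 U41 U42
    Y1 Y2 Y3 Y3' ->
  Y3 = Y3' /\ solution Y1 Y2 Y3.
Proof.
case=> p1 p2 p3 p4 p5 [Y1E Y2E Y3E Y3'E].
have proj : projections C1 C2 C3 A33 B33 D2 D3 D4 E1 E2 E3 E4 by split.
have [Y3eq Yeq] := equations_sound C2E C3E C1_C2 C1_C3 D2E D3E D4_D2 D4_D3
  E1_E2 E1_E3 E2_E4 E3_E4 C11E D11E E11E E22E E33E E44E ME NE SE F1E F2E FE EE
  U11 U12 U21 U31 U32 U33 U41 (- U42) proj p5.
rewrite /two_term_Y mulNmx [X in L_ C3 *m X]addrAC in Y3eq Yeq.
rewrite -Y3E -Y3'E in Y3eq Yeq; split=> //.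
have [c1 c2 c3 c4] := (reduced_conditions Y3).2 Yeq.
apply/solution_two_term; rewrite Y1E Y2E.
exact: (two_term_sound M1E N1E S1E).
Qed.

Lemma general_solution_complete Y1 Y2 Y3 : solution Y1 Y2 Y3 ->
  exists U4 U5 U6 U7 U8 U11 U12 U21 U31 U32 U33 U41 U42,
    general_solution U4 U5 U6 U7 U8 U11 U12 U21 U31 U32 U33 U41 U42
      Y1 Y2 Y3 Y3.
Proof.
move=> sol; have Yeq := solution_equations sol.
have [U11 [U12 [U21 [U31 [U32 [U33 [U41 [U42 [Y3E Y3'E]]]]]]]]] :=
  equations_complete C3E C1_C2 D2E D4_D3 E1_E2 E3_E4 C11E D11E
  E11E E22E E33E E44E ME NE SE F1E F2E FE EE
  Yeq.
have /solution_two_term/(two_term_complete M1E N1E S1E) := sol.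
case=> [U4 [U5 [U6 [U7 [U8 [Y1E Y2E]]]]]].
exists U4, U5, U6, U7, U8, U11, U12, U21, U31, U32, U33, U41, (- U42).
by rewrite /general_solution mulNmx opprK [X in L_ C3 *m X]addrAC; split.
Qed.

Lemma consistent_projection_conditions :
  (exists Y1 Y2 Y3, solution Y1 Y2 Y3) <-> projection_conditions.
Proof.
split=> [[Y1 [Y2 [Y3 /solution_equations Yeq]]]|proj].
  have [p1 p2 p3 p4] := equations_projections Yeq; split=> //.
  exact: (equations_projection C3E C1_C2 D2E D4_D3 E1_E2 E3_E4 C11E D11E E11E
    E22E E33E E44E ME NE F1E F2E FE EE Yeq).
(* A solution is exhibited by setting all thirteen parameters to zero. *)
have [_ sol] := @general_solution_sound 0 0 0 0 0 0 0 0 0 0 0 0 0 _ _ _ _ proj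
  (And4 erefl erefl erefl erefl).
by do 3!eexists; exact: sol.
Qed.

(** Condition 7 relies on [F1] and [F2] solving equations 2 and 3, which the other eight projection
    conditions guarantee; its equivalence is therefore conditional on them. *)
Lemma projection_conditions_blocks :
  projection_conditions <-> block_conditions.
Proof.
have block7 (proj : projections C1 C2 C3 A33 B33 D2 D3 D4 E1 E2 E3 E4) :=
  let: And4 _ F1P F2P _ :=
    equations_particular C3E C1_C2 D2E D4_D3 E1_E2 E3_E4 F1E F2E proj in
  block_condition7 C11E D11E E22E E33E F1P F2P FE EE.
rewrite /block_conditions.
split=> [[[p1 p1'] [p2 p2'] [p3 p3'] [p4 p4'] p5]|].
  rewrite block_condition1 block_condition2 block_condition3 block_condition4.
  rewrite block_condition5 block_condition6 block_condition8 block_condition9.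
  by do !split=> //; apply/block7.
rewrite block_condition1 block_condition2 block_condition3 block_condition4.
rewrite block_condition5 block_condition6 block_condition8 block_condition9.
move=> [p1 [p4' [p1' [p2 [p3 [p4 [p7 [p3' p2']]]]]]]].
by split=> //; apply/block7.
Qed.

Theorem three_term_equation :
  [/\ (exists Y1 Y2 Y3, solution Y1 Y2 Y3) <-> projection_conditions,
      projection_conditions <-> block_conditions &
      (exists Y1 Y2 Y3, solution Y1 Y2 Y3) ->
      (forall U4 U5 U6 U7 U8 U11 U12 U21 U31 U32 U33 U41 U42 Y1 Y2 Y3 Y3',
        general_solution U4 U5 U6 U7 U8 U11 U12 U21 U31 U32 U33 U41 U42
          Y1 Y2 Y3 Y3' ->
        Y3 = Y3' /\ solution Y1 Y2 Y3) /\
      (forall Y1 Y2 Y3, solution Y1 Y2 Y3 ->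
        exists U4 U5 U6 U7 U8 U11 U12 U21 U31 U32 U33 U41 U42,
          general_solution U4 U5 U6 U7 U8 U11 U12 U21 U31 U32 U33 U41 U42
            Y1 Y2 Y3 Y3)].
Proof.
split; first exact: consistent_projection_conditions.
  exact: projection_conditions_blocks.
move/consistent_projection_conditions => proj; split.
  by move=> *; apply: general_solution_sound; eassumption.
exact: general_solution_complete.
Qed.

End Solutions.

End ThreeTerms.

(** Grouping the first two block rows and columns gives a two-by-two matrix with a zero corner, as
    the block rank formula requires. The cast reconciles the two bracketings of the sizes. *)
Lemma block_reassoc p q a1 a2 m b1 b2 n (T1 T2 : 'H_(p, q))
    (A11 : 'H_(p, a1)) (A22 : 'H_(p, a2)) (A33 : 'H_(p, m))
    (B11 : 'H_(b1, q)) (B22 : 'H_(b2, q)) (B33 : 'H_(n, q)) :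
  col_mx (row_mx T1  (row_mx 0     (row_mx A11 (row_mx 0   A33))))
  (col_mx (row_mx 0   (row_mx T2    (row_mx 0   (row_mx A22 A33))))
  (col_mx (row_mx B22 (row_mx 0     (row_mx 0   (row_mx 0   0))))
  (col_mx (row_mx 0   (row_mx B11   (row_mx 0   (row_mx 0   0))))
          (row_mx B33 (row_mx B33   (row_mx 0   (row_mx 0   0)))))))
  = castmx (esym (addnA p p _), esym (addnA q q _))
     (col_mx (row_mx (col_mx (row_mx T1 0) (row_mx 0 T2))
                     (col_mx (row_mx A11 (row_mx 0 A33))
                             (row_mx 0 (row_mx A22 A33))))
             (row_mx (col_mx (row_mx B22 0)
                             (col_mx (row_mx 0 B11) (row_mx B33 B33))) 0)).
Proof.
have castC r1 r2 c c' (e : c = c') (X : 'H_(r1, c)) (Y : 'H_(r2, c)) :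
    castmx (erefl, e) (col_mx X Y)
    = col_mx (castmx (erefl, e) X) (castmx (erefl, e) Y) by case: c' / e.
have castE r r' c c' (e : r = r') (f : c = c') (X : 'H_(r, c)) :
    castmx (e, f) X = castmx (erefl, f) (castmx (e, erefl) X).
  by case: r' / e; case: c' / f.
have rowE r1 r2 c1 c2 (X1 : 'H_(r1, c1)) (X2 : 'H_(r1, c2)) (Y1 : 'H_(r2, c1))
    (Y2 : 'H_(r2, c2)) : row_mx (col_mx X1 Y1) (col_mx X2 Y2)
    = col_mx (row_mx X1 X2) (row_mx Y1 Y2).
  by rewrite -block_mxEv block_mxEh.
rewrite castE rowE -col_mxA.
rewrite -[0 as X in row_mx (col_mx _ _) X]col_mx0 rowE.
rewrite -[0 as X in row_mx (col_mx _ _) X]col_mx0 rowE.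
by rewrite !castC -!row_mxA !row_mx0.
Qed.

End Equations.

(** * Moore-Penrose inverses and ranks of quaternion matrices *)

Section QuaternionField.
Variable R : realType.
Implicit Types x y : quaternion R.

Definition normq x : R := qre x ^+ 2 + qi x ^+ 2 + qj x ^+ 2 + qk x ^+ 2.

Lemma normq_ge0 x : 0 <= normq x.
Proof. by rewrite /normq !addr_ge0 ?sqr_ge0. Qed.

Lemma normq_eq0 x : normq x = 0 -> x = 0.
Proof.
move/eqP; rewrite /normq !paddr_eq0 ?addr_ge0 ?sqr_ge0 // !sqrf_eq0.
by case: x => a b c d /= /andP[/andP[/andP[/eqP-> /eqP->] /eqP->] /eqP->].
Qed.

Lemma qreD x y : qre (x + y) = qre x + qre y. Proof. by []. Qed.

Lemma qre_sum I (r : seq I) P (F : I -> quaternion R) :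
  qre (\sum_(i <- r | P i) F i) = \sum_(i <- r | P i) qre (F i).
Proof. exact: (big_morph _ qreD). Qed.

Lemma qre_mulC x y : qre (x * y) = qre (y * x).
Proof. by rewrite /=; ring. Qed.

Lemma qre_conj_mul x : qre (conjq x * x) = normq x.
Proof. by rewrite /normq /=; ring. Qed.

Lemma conjqD x y : conjq (x + y) = conjq x + conjq y.
Proof. by congr Quaternion => /=; ring. Qed.

Lemma conjqM x y : conjq (x * y) = conjq y * conjq x.
Proof. by congr Quaternion => /=; ring. Qed.

Lemma conjqK : involutive (@conjq R).
Proof. by case=> a b c d; rewrite /conjq /= !opprK. Qed.

Lemma conjq0 : conjq (0 : quaternion R) = 0.
Proof. by congr Quaternion => /=; rewrite oppr0. Qed.

Lemma conjq_sum I (r : seq I) P (F : I -> quaternion R) :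
  conjq (\sum_(i <- r | P i) F i) = \sum_(i <- r | P i) conjq (F i).
Proof. exact: (big_morph _ conjqD conjq0). Qed.

Definition invq x : quaternion R :=
  Quaternion (qre x / normq x) (- qi x / normq x)
             (- qj x / normq x) (- qk x / normq x).

Lemma mulVq x : x != 0 -> invq x * x = 1.
Proof.
move=> x0; have n0 : normq x != 0 by apply: contra_neq x0; exact: normq_eq0.
have -> : 1 = Quaternion 1 0 0 0 :> quaternion R by [].
by congr Quaternion; rewrite /= /normq in n0 *; field.
Qed.

Lemma mulqV x : x != 0 -> x * invq x = 1.
Proof.
move=> x0; have n0 : normq x != 0 by apply: contra_neq x0; exact: normq_eq0.
have -> : 1 = Quaternion 1 0 0 0 :> quaternion R by [].
by congr Quaternion; rewrite /= /normq in n0 *; field.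
Qed.

End QuaternionField.

(** * Existence and absorption properties of the Moore-Penrose inverse *)

Section MoorePenrose.
Variable R : realType.
Local Notation "''H_' ( m , n )" := 'M[quaternion R]_(m, n)
  (format "''H_' ( m ,  n )").

Lemma conjtrmxM m n p (A : 'H_(m, n)) (B : 'H_(n, p)) :
  conjtrmx (A *m B) = conjtrmx B *m conjtrmx A.
Proof.
apply/matrixP => i j; rewrite !mxE conjq_sum; apply: eq_bigr => k _.
by rewrite !mxE conjqM.
Qed.

Lemma conjtrmxK m n (A : 'H_(m, n)) : conjtrmx (conjtrmx A) = A.
Proof. by apply/matrixP => i j; rewrite !mxE conjqK. Qed.

Lemma conjtrmx1 n : conjtrmx (1%:M : 'H_(n, n)) = 1%:M.
Proof.
apply/matrixP => i j; rewrite !mxE eq_sym.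
by case: eqP => _; congr Quaternion; rewrite /= ?oppr0.
Qed.

Lemma conjtrmxB m n (A B : 'H_(m, n)) :
  conjtrmx (A - B) = conjtrmx A - conjtrmx B.
Proof. by apply/matrixP => i j; rewrite !mxE; congr Quaternion => /=; ring. Qed.

(** The quaternion trace is not cyclic, but its real part is, because
    [qre (x * y) = qre (y * x)]. *)
Definition retr n (A : 'H_(n, n)) : R := qre (\tr A).

Lemma retr_mulC m n (A : 'H_(m, n)) (B : 'H_(n, m)) :
  retr (A *m B) = retr (B *m A).
Proof.
rewrite /retr /mxtrace !qre_sum.
under eq_bigr do rewrite mxE qre_sum.
under [RHS]eq_bigr do rewrite mxE qre_sum.
by rewrite exchange_big; apply: eq_bigr => i _; apply: eq_bigr => j _;
   rewrite qre_mulC.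
Qed.

Lemma retr_gram m n (A : 'H_(m, n)) :
  retr (conjtrmx A *m A) = \sum_i \sum_j normq (A j i).
Proof.
rewrite /retr /mxtrace qre_sum; apply: eq_bigr => i _.
by rewrite mxE qre_sum; apply: eq_bigr => j _; rewrite !mxE qre_conj_mul.
Qed.

Lemma gram_eq0 m n (A : 'H_(m, n)) : conjtrmx A *m A = 0 -> A = 0.
Proof.
move=> A0; have /eqP : \sum_i \sum_j normq (A j i) = 0.
  by rewrite -retr_gram A0 /retr mxtrace0.
rewrite psumr_eq0 => [/allP Ai0|i _]; last first.
  by apply: sumr_ge0 => j _; exact: normq_ge0.
apply/matrixP => j i; rewrite mxE; have := Ai0 i (mem_index_enum _).
rewrite /= psumr_eq0; last by move=> *; exact: normq_ge0.
by move=> /allP/(_ j (mem_index_enum _))/eqP/normq_eq0.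
Qed.

(* With [c := a - B G a] the part of [a] outside the columns of [B]: if [c = 0],
   pad [G] with a zero row; otherwise use a row [d] with [d B = 0], [d a = 1]. *)
Lemma inner_inverse_row m n (a : 'H_(m, 1)) (B : 'H_(m, n)) (G : 'H_(n, m)) :
  B *m G *m B = B ->
  exists K : 'H_(1 + n, m), row_mx a B *m K *m row_mx a B = row_mx a B.
Proof.
move=> BGB; pose c := a - B *m G *m a.
have [c0|/matrix0Pn [i [j cij]]] := eqVneq c 0.
  exists (col_mx 0 G).
  rewrite mul_row_col mulmx0 add0r mul_mx_row BGB; congr row_mx.
  by apply/esym/eqP; rewrite -subr_eq0 -/c c0.
pose d0 : 'H_(1, m) := invq (c i j) *: delta_mx 0 i.
pose d := d0 *m (1%:M - B *m G).
have dB : d *m B = 0 by rewrite -mulmxA mulmxBl mul1mx BGB subrr mulmx0.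
have da : d *m a = 1%:M.
  rewrite -mulmxA mulmxBl mul1mx -/c -scalemxAl -rowE.
  apply/matrixP => k l; rewrite !ord1 !mxE /=.
  by apply: mulVq; move: cij; rewrite (ord1 j) !mxE.
exists (col_mx d (G *m (1%:M - a *m d))); clearbody d.
rewrite mul_row_col mul_mx_row !mulmxDl; congr row_mx.
  by rewrite -!mulmxA da mulmx1 mulmxBl mul1mx -!mulmxA da mulmx1
             subrr !mulmx0 addr0.
by rewrite -!mulmxA dB mulmx0 add0r mulmxBl mul1mx -!mulmxA dB !mulmx0
           subr0 mulmxA BGB.
Qed.

Lemma inner_inverse m n (A : 'H_(m, n)) : exists G, A *m G *m A = A.
Proof.
elim: n A => [|n IHn] A; first by exists 0; apply/matrixP => i [].
have [G BGB] := IHn (rsubmx (A : 'M_(m, 1 + n))).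
have [K] := inner_inverse_row (lsubmx (A : 'M_(m, 1 + n))) BGB.
by rewrite hsubmxK => AKA; exists K.
Qed.

Lemma gram_cancel m n p (A : 'H_(m, n)) (X Y : 'H_(n, p)) :
  conjtrmx A *m A *m X = conjtrmx A *m A *m Y -> A *m X = A *m Y.
Proof.
move=> /eqP; rewrite -subr_eq0 -mulmxBr => /eqP AX.
apply/eqP; rewrite -subr_eq0 -mulmxBr; apply/eqP/gram_eq0.
by rewrite conjtrmxM -mulmxA [_ *m (A *m _)]mulmxA AX mulmx0.
Qed.

(** For an inner inverse [G] of [conjtrmx A *m A], the matrix [P = A G (conjtrmx A)] satisfies
    [P A = A], hence [P (conjtrmx P) = P], which forces [P] to be Hermitian. *)
Lemma left_projection m n (A : 'H_(m, n)) :
  exists G, A *m G *m A = A /\ conjtrmx (A *m G) = A *m G.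
Proof.
have [G GP] := inner_inverse (conjtrmx A *m A).
have AGA : A *m (G *m conjtrmx A *m A) = A.
  by rewrite -[RHS]mulmx1; apply: gram_cancel; rewrite mulmx1 -[RHS]GP !mulmxA.
exists (G *m conjtrmx A); split; first by rewrite -mulmxA.
set P := A *m _; have PA : P *m A = A by rewrite /P -mulmxA AGA.
have PP : P *m conjtrmx P = P.
  by rewrite {1}/P -!mulmxA -conjtrmxM PA.
by rewrite -PP conjtrmxM conjtrmxK.
Qed.

(* Penrose's formula [L A G] with [A G] and [L A] orthogonal projections. *)
Lemma mpinv_exists m n (A : 'H_(m, n)) : exists Y, is_mpinv A Y.
Proof.
have [G [AGA Gh]] := left_projection A.
have [K [AKA Kh]] := left_projection (conjtrmx A).
pose L := conjtrmx K.
have LA : conjtrmx (L *m A) = L *m A.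
  by rewrite conjtrmxM conjtrmxK -[LHS]Kh conjtrmxM conjtrmxK.
have ALA : A *m L *m A = A.
  by apply: (can_inj (@conjtrmxK _ _)); rewrite -[RHS]AKA !conjtrmxM conjtrmxK
     !mulmxA.
have YA : L *m A *m G *m A = L *m A.
  by rewrite -2!mulmxA [A *m (G *m A)]mulmxA AGA.
exists (L *m A *m G); split.
- by rewrite !mulmxA ALA AGA.
- by rewrite YA -!mulmxA; congr (L *m _); rewrite !mulmxA ALA.
- by rewrite !mulmxA ALA.
- by rewrite YA.
Qed.

Section Projections.
Variables (m n : nat) (A : 'H_(m, n)).

Lemma mpinvP : is_mpinv A A^†.
Proof.
by have [Y AY] := mpinv_exists A; apply: classical_sets.xgetPex; exists Y.
Qed.

Lemma mpinvK : A *m A^† *m A = A. Proof. by case: mpinvP. Qed.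

Lemma R_conj : conjtrmx (R_ A) = R_ A.
Proof. by rewrite conjtrmxB conjtrmx1; case: mpinvP => _ _ -> _. Qed.

Lemma L_conj : conjtrmx (L_ A) = L_ A.
Proof. by rewrite conjtrmxB conjtrmx1; case: mpinvP => _ _ _ ->. Qed.

(** [P A A^† = A A^†] has Hermitian factors [P] and [A A^†], so taking adjoints moves [P] to the
    right. *)
Lemma mpinv_absorbr (P : 'H_(m, m)) :
  conjtrmx P = P -> P *m A = A -> A^† *m P = A^†.
Proof.
have [_ AAA AAh _] := mpinvP => Ph PA.
have APA : A *m A^† *m P = A *m A^†.
  by rewrite -[in LHS]AAh -{1}Ph -conjtrmxM mulmxA PA AAh.
by rewrite -{1}AAA -!mulmxA (mulmxA A) APA mulmxA.
Qed.

Lemma mpinv_absorbl (P : 'H_(n, n)) :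
  conjtrmx P = P -> A *m P = A -> P *m A^† = A^†.
Proof.
have [_ AAA _ AAh] := mpinvP => Ph AP.
have PAA : P *m (A^† *m A) = A^† *m A.
  by rewrite -[in LHS]AAh -{1}Ph -conjtrmxM -mulmxA AP AAh.
by rewrite -{1}AAA mulmxA PAA.
Qed.

End Projections.

End MoorePenrose.

(** * Rank over the quaternions through full-rank factorizations *)

Section Rank.
Variable R : realType.
Local Notation "''H_' ( m , n )" := 'M[quaternion R]_(m, n)
  (format "''H_' ( m ,  n )").

Let L_def m n (A : 'H_(m, n)) : L_ A = 1%:M - A^† *m A := erefl.
Let R_def m n (A : 'H_(m, n)) : R_ A = 1%:M - A *m A^† := erefl.
Let R_mul := R_mul (@mpinvK R) R_def.
Let mul_L := mul_L (@mpinvK R) L_def.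
Let R_idem := R_idem (@mpinvK R) R_def.
Let L_idem := L_idem (@mpinvK R) L_def.
Let R_mul_eq0 := R_mul_eq0 R_def.

Lemma retrB n (A B : 'H_(n, n)) : retr (A - B) = retr A - retr B.
Proof. by rewrite /retr raddfB. Qed.

Lemma retr1 n : retr (1%:M : 'H_(n, n)) = n%:R.
Proof.
rewrite /retr mxtrace1; elim: n => // n IHn.
by rewrite -[in LHS]addn1 natrD qreD IHn -[n.+1]addn1 natrD.
Qed.

Lemma retr_R_ge0 m n (A : 'H_(m, n)) : 0 <= retr (R_ A).
Proof.
rewrite -R_idem -{1}R_conj retr_gram.
by apply: sumr_ge0 => i _; apply: sumr_ge0 => j _; exact: normq_ge0.
Qed.

(* [R_ Y] is an orthogonal projection, so its trace [s - r] has nonnegative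
   real part. *)
Lemma leq_one_sided_inverse r s (X : 'H_(r, s)) (Y : 'H_(s, r)) :
  X *m Y = 1%:M -> (r <= s)%N.
Proof.
move=> XY; have YY : Y^† *m Y = 1%:M.
  by rewrite -[LHS]mul1mx -XY -mulmxA [Y *m _]mulmxA mpinvK XY.
rewrite -(ler_nat R) -subr_ge0.
have -> : s%:R - r%:R = retr (R_ Y) :> R.
  by rewrite retrB !retr1 retr_mulC YY retr1.
exact: retr_R_ge0.
Qed.

Lemma qrank_free m n (A : 'H_(m, n)) : exists2 J : {set 'I_n},
  qrank A = #|J| & columns_free A J /\
  forall k, k \notin J -> ~ columns_free A (k |: J).
Proof.
have free0 : `[< columns_free A set0 >].
  by apply/asboolP => x x0 _; apply/matrixP => i j; rewrite ord1 mxE x0 ?inE.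
have [|J /asboolP freeJ JE] :=
  @eq_bigmax_cond {set 'I_n} (fun J => `[< columns_free A J >]) (fun J => #|J|).
  by apply/card_gt0P; exists set0.
exists J => //; split=> // k kJ freek.
have : (#|k |: J| <= #|J|)%N by rewrite -JE leq_bigmax_cond //; apply/asboolP.
by rewrite cardsU1 kJ add1n ltnn.
Qed.

(** [X] consists of the columns in a maximal free set [J]. Freeness gives [X^† X = 1], maximality
    gives [A = X X^† A], and the selection matrix inverts [X^† A] on the right. *)
Lemma qrank_factor m n (A : 'H_(m, n)) :
  exists r (X : 'H_(m, r)) (Y : 'H_(r, n)) (X' : 'H_(r, m)) (Y' : 'H_(n, r)),
    [/\ qrank A = r, A = X *m Y, X' *m X = 1%:M & Y *m Y' = 1%:M].
Proof.
have [J rE [freeJ maxJ]] := qrank_free A.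
pose Sel : 'H_(n, #|J|) := \matrix_(i, k) (i == enum_val k)%:R.
have ASel i k : (A *m Sel) i k = A i (enum_val k).
  rewrite mxE (bigD1 (enum_val k)) //= mxE eqxx mulr1 big1 ?addr0 // => j jk.
  by rewrite mxE (negPf jk) mulr0.
pose X := A *m Sel.
have XX : X^† *m X = 1%:M.
  apply/esym/eqP; rewrite -subr_eq0; apply/eqP.
  have SelJ (x : 'cV_#|J|) (j : 'I_n) : j \notin J -> (Sel *m x) j 0 = 0.
    move=> jJ; rewrite mxE big1 // => k _; rewrite mxE.
    by case: eqP jJ => [->|]; rewrite ?enum_valP ?mul0r.
  have SelE (x : 'cV_#|J|) k : (Sel *m x) (enum_val k) 0 = x k 0.
    rewrite mxE (bigD1 k) //= mxE eqxx mul1r big1 ?addr0 // => l lk.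
    by rewrite mxE (inj_eq enum_val_inj) eq_sym (negPf lk) mul0r.
  apply/matrixP => k l.
  (* Each column of [L_ X], spread over [J], is killed by [A], so freeness makes it zero. *)
  have /matrixP/(_ (enum_val k) 0) : Sel *m col l (L_ X) = 0.
    apply: freeJ => [j jJ|]; first exact: SelJ.
    by rewrite mulmxA -/X colE mulmxA mul_L mul0mx.
  by rewrite SelE !mxE.
have RXA : R_ X *m A = 0.
  have RXJ i k : k \in J -> (R_ X *m A) i k = 0.
    move=> kJ; have := R_mul X; rewrite mulmxA => /matrixP.
    move=> /(_ i (enum_rank_in kJ k)); rewrite [RHS]mxE => <-.
    rewrite [RHS]mxE (bigD1 k) //= [Sel _ _]mxE enum_rankK_in // eqxx mulr1.
    rewrite big1 ?addr0 // => j jk.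
    by rewrite [Sel _ _]mxE enum_rankK_in // (negPf jk) mulr0.
  apply/matrixP => i k; rewrite [RHS]mxE.
  have [/RXJ//|kJ] := boolP (k \in J).
  (* A relation [x] on [J] and [k] must have [x k 0 != 0], by freeness of [J]. As [R_ X *m A]
     vanishes on the columns in [J], dividing by this entry on the right shows that it vanishes on
     column [k] too. *)
  have /existsNP [x /not_implyP [xJ /not_implyP [Ax0 xn0]]] := maxJ k kJ.
  have : (R_ X *m A *m x) i 0 = 0 by rewrite -mulmxA Ax0 mulmx0 mxE.
  rewrite mxE (bigD1 k) //= big1 => [|j jk]; last first.
    have [jJ|jJ] := boolP (j \in J); first by rewrite RXJ ?mul0r.
    by rewrite xJ ?mulr0 // !inE negb_or jk.
  rewrite addr0 => Wx; have xk : x k 0 != 0.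
    apply/eqP => xk; apply: xn0; apply: freeJ => // j jJ.
    have [->//|jk] := eqVneq j k.
    by apply: xJ; rewrite !inE negb_or jk.
  by rewrite -[LHS]mulr1 -(mulqV xk) mulrA Wx mul0r.
exists #|J|, X, (X^† *m A), X^†, Sel; split=> //; last by rewrite -mulmxA.
by rewrite mulmxA; apply/esym/R_mul_eq0.
Qed.

Lemma qrank_ge m n s (A : 'H_(m, n)) (P : 'H_(s, m)) (Q : 'H_(n, s)) :
  P *m A *m Q = 1%:M -> (s <= qrank A)%N.
Proof.
have [r [X [Y [_ [_ [-> -> _ _]]]]]] := qrank_factor A.
by rewrite mulmxA -mulmxA; exact: leq_one_sided_inverse.
Qed.

Lemma qrank_le m n s (X : 'H_(m, s)) (Y : 'H_(s, n)) :
  (qrank (X *m Y) <= s)%N.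
Proof.
have [r [U [V [U' [V' [-> XY UU VV]]]]]] := qrank_factor (X *m Y).
apply: (@leq_one_sided_inverse _ _ (U' *m X) (Y *m V')).
by rewrite mulmxA -[U' *m X *m Y]mulmxA XY mulmxA UU mul1mx.
Qed.

Lemma qrank_mul_le m n p q (P : 'H_(p, m)) (A : 'H_(m, n)) (Q : 'H_(n, q)) :
  (qrank (P *m A *m Q) <= qrank A)%N.
Proof.
have [r [X [Y [_ [_ [-> -> _ _]]]]]] := qrank_factor A.
by rewrite mulmxA -mulmxA; exact: qrank_le.
Qed.

Lemma qrank_unique m n s (A : 'H_(m, n)) X' Y' (X : 'H_(m, s)) (Y : 'H_(s, n)) :
  A = X *m Y -> X' *m X = 1%:M -> Y *m Y' = 1%:M -> qrank A = s.
Proof.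
move=> -> XX YY; apply/eqP; rewrite eqn_leq qrank_le /=.
by apply: (@qrank_ge _ _ _ _ X' Y'); rewrite mulmxA XX mul1mx.
Qed.

Lemma qrank_equiv m n p q (A : 'H_(m, n)) (B : 'H_(p, q)) P Q P' Q' :
  B = P *m A *m Q -> A = P' *m B *m Q' -> qrank A = qrank B.
Proof.
move=> BE AE; apply/eqP; rewrite eqn_leq.
by apply/andP; split; [rewrite AE | rewrite BE]; exact: qrank_mul_le.
Qed.

Lemma qrank_eq0 m n (A : 'H_(m, n)) : qrank A = 0%N <-> A = 0.
Proof.
split=> [|->].
  have [r [X [Y [_ [_ [-> -> _ _]]]]]] := qrank_factor A => r0.
  by apply/matrixP => i j; rewrite !mxE big1 // => k; case: r0 k X Y => -> [].
apply/eqP; rewrite -leqn0 -(mul0mx _ (0 : 'H_(0, n))); exact: qrank_le.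
Qed.

(** Full-rank factorizations of [W], [A] and [B] assemble into one of the block matrix. [R_ A] fixes
    [X3] and kills [X1], so it separates their left inverses; [L_ B] does the same for [Y3] and
    [Y2]. *)
Lemma qrank_anti_triangular m n p q (W : 'H_(m, n)) (A : 'H_(m, p))
    (B : 'H_(q, n)) : R_ A *m W = W -> W *m L_ B = W ->
  qrank (col_mx (row_mx W A) (row_mx B 0)) = (qrank W + (qrank A + qrank B))%N.
Proof.
move=> RW WL.
have [r1 [X1 [Y1 [X1' [Y1' [-> AE XX1 YY1]]]]]] := qrank_factor A.
have [r2 [X2 [Y2 [X2' [Y2' [-> BE XX2 YY2]]]]]] := qrank_factor B.
have [r3 [X3 [Y3 [X3' [Y3' [-> WE XX3 YY3]]]]]] := qrank_factor W.
have RX1 : R_ A *m X1 = 0.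
  by rewrite -[X1]mulmx1 -YY1 [X1 *m _]mulmxA -AE mulmxA R_mul mul0mx.
have RX3 : R_ A *m X3 = X3.
  by rewrite -[X3]mulmx1 -YY3 [X3 *m _]mulmxA -WE mulmxA RW.
have LY2 : Y2 *m L_ B = 0.
  by rewrite -[Y2]mul1mx -XX2 -[X2' *m _ *m _]mulmxA -BE -mulmxA mul_L mulmx0.
have LY3 : Y3 *m L_ B = Y3.
  by rewrite -[Y3]mul1mx -XX3 -[X3' *m _ *m _]mulmxA -WE -mulmxA WL.
move: (R_ A) (L_ B) RX1 RX3 LY2 LY3 => P Q RX1 RX3 LY2 LY3.
apply: (@qrank_unique _ _ _ _
  (col_mx (row_mx (X3' *m P) 0)
   (col_mx (row_mx (X1' *m (1%:M - P)) 0) (row_mx 0 X2')))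
  (row_mx (col_mx (Q *m Y3') 0)
   (row_mx (col_mx 0 Y1') (col_mx ((1%:M - Q) *m Y2') 0)))
  (row_mx (col_mx X3 0) (row_mx (col_mx X1 0) (col_mx 0 X2)))
  (col_mx (row_mx Y3 0) (col_mx (row_mx 0 Y1) (row_mx Y2 0)))).
- rewrite !mul_row_col !mul_col_row !add_col_mx !add_row_mx.
  by rewrite !(mulmx0, mul0mx, addr0, add0r) -WE -AE -BE.
- rewrite !mul_col_row !mul_mx_row !mul_col_mx !mul_row_col.
  rewrite !(mulmx0, mul0mx, addr0, add0r).
  rewrite -!mulmxA !mulmxBl !mul1mx RX1 RX3 subrr subr0 !mulmx0 XX1 XX2 XX3.
  by rewrite row_mx0 col_mx0 -!scalar_mx_block.
 
- rewrite !mul_col_row !mul_mx_row !mul_col_mx !mul_row_col.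
  rewrite !(mulmx0, mul0mx, addr0, add0r).
  rewrite !mulmxA !mulmxBr !mulmx1 LY2 LY3 subrr subr0 !mul0mx YY1 YY2 YY3.
  by rewrite row_mx0 col_mx0 -!scalar_mx_block.
Qed.

Lemma qrank_block m n p q (T : 'H_(m, n)) (A : 'H_(m, p)) (B : 'H_(q, n)) :
  qrank (col_mx (row_mx T A) (row_mx B 0)) =
  (qrank (R_ A *m T *m L_ B) + (qrank A + qrank B))%N.
Proof.
set W := R_ A *m T *m L_ B.
rewrite -qrank_anti_triangular; first last.
- by rewrite /W -!mulmxA L_idem.
- by rewrite /W !mulmxA R_idem.
(* Besides [W], this leaves a right multiple of [A] and a left multiple of [B], which column and row
   operations clear. *)
have TE : T = W + A *m A^† *m T + R_ A *m T *m B^† *m B.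
  have -> : A *m A^† *m T = T - R_ A *m T.
    by rewrite mulmxBl mul1mx opprB addrC subrK.
  by rewrite /W mulmxBr mulmx1 mulmxA addrAC subrK addrC subrK.
apply: (@qrank_equiv _ _ _ _ _ _
  (block_mx 1%:M (- (R_ A *m T *m B^†)) 0 1%:M)
  (block_mx 1%:M 0 (- (A^† *m T)) 1%:M)
  (block_mx 1%:M (R_ A *m T *m B^†) 0 1%:M)
  (block_mx 1%:M 0 (A^† *m T) 1%:M)); rewrite -!/(block_mx _ _ _ _).
- rewrite !mulmx_block !(mulmx0, mul0mx, addr0, add0r, mul1mx, mulmx1).
  congr (block_mx _ _ _ _).
  rewrite mulmxN mulNmx mulmxA; move: TE.
  by move: (A *m _ *m T) (R_ A *m T *m _ *m B) => a b ->; rewrite addrK addrK.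
- rewrite !mulmx_block !(mulmx0, mul0mx, addr0, add0r, mul1mx, mulmx1).
  congr (block_mx _ _ _ _).
  by rewrite mulmxA addrAC.
Qed.

Lemma qrank_block_eq m n p q (T : 'H_(m, n)) (A : 'H_(m, p)) (B : 'H_(q, n)) :
  qrank (col_mx (row_mx T A) (row_mx B 0)) = (qrank A + qrank B)%N <->
  R_ A *m T *m L_ B = 0.
Proof.
rewrite qrank_block -qrank_eq0; split=> [rE|->//].
by apply/eqP; rewrite -(eqn_add2r (qrank A + qrank B)) rE.
Qed.

(** This is the block formula for a [B] with no rows, where [L_ B] is the identity. *)
Lemma qrank_row_eq m n p (T : 'H_(m, n)) (A : 'H_(m, p)) :
  qrank (row_mx T A) = qrank A <-> R_ A *m T = 0.
Proof.
have := qrank_block_eq T A (0 : 'H_(0, n)).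
have -> : qrank (0 : 'H_(0, n)) = 0%N by apply/qrank_eq0.
have -> : L_ (0 : 'H_(0, n)) = 1%:M by rewrite /L_ mulmx0 subr0.
rewrite [(qrank A + _)%N]addn0 mulmx1 row_mx0.
have <- // : qrank (row_mx T A) = qrank (col_mx (row_mx T A) (0 : 'H_(0, _))).
apply: (@qrank_equiv _ _ _ _ _ _ (col_mx 1%:M 0) 1%:M (row_mx 1%:M 0) 1%:M).
- by rewrite mulmx1 mul_col_mx mul1mx mul0mx.
- by rewrite mulmx1 mul_row_col mul1mx mul0mx addr0.
Qed.

Lemma qrank_col_eq m n q (T : 'H_(m, n)) (B : 'H_(q, n)) :
  qrank (col_mx T B) = qrank B <-> T *m L_ B = 0.
Proof.
have := qrank_block_eq T (0 : 'H_(m, 0)) B.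
have -> : qrank (0 : 'H_(m, 0)) = 0%N by apply/qrank_eq0.
have -> : R_ (0 : 'H_(m, 0)) = 1%:M by rewrite /R_ mul0mx subr0.
rewrite [(0 + qrank B)%N]add0n mul1mx.
have <- // : qrank (col_mx T B) =
  qrank (col_mx (row_mx T (0 : 'H_(m, 0))) (row_mx B 0)).
rewrite -[col_mx (row_mx _ _) _]/(block_mx _ _ _ _) block_mxEh col_mx0.
apply: (@qrank_equiv _ _ _ _ _ _ 1%:M (row_mx 1%:M 0) 1%:M (col_mx 1%:M 0)).
- by rewrite mul1mx mul_mx_row mulmx1 mulmx0.
- by rewrite mul1mx mul_row_col mulmx1 mulmx0 addr0.
Qed.

Lemma qrank_cast m n m' n' (eqmn : (m = m') * (n = n')) (A : 'H_(m, n)) :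
  qrank (castmx eqmn A) = qrank A.
Proof. by case: eqmn => em en; case: m' / em; case: n' / en. Qed.

End Rank.

(** * Specialization to quaternion matrices *)

Lemma mpinv_absorb_R (R : realType) m n p (A : 'M[quaternion R]_(m, n))
    (B : 'M[quaternion R]_(m, p)) : R_ B *m A = A -> A^† *m R_ B = A^†.
Proof. exact: mpinv_absorbr (R_conj B). Qed.

Lemma L_mpinv_absorb (R : realType) m n p (A : 'M[quaternion R]_(m, n))
    (B : 'M[quaternion R]_(p, n)) : A *m L_ B = A -> L_ B *m A^† = A^†.
Proof. exact: mpinv_absorbl (L_conj B). Qed.

Lemma qrank_col_block_eq (R : realType) m n p q r
    (T : 'M[quaternion R]_(m, n)) (A : 'M[quaternion R]_(m, p))
    (B : 'M[quaternion R]_(q, n)) (B' : 'M[quaternion R]_(r, n)) :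
  qrank (col_mx (row_mx T A) (col_mx (row_mx B 0) (row_mx B' 0)))
    = (qrank (col_mx B B') + qrank A)%N <->
  R_ A *m T *m L_ (col_mx B B') = 0.
Proof.
rewrite [(qrank (col_mx B B') + _)%N]addnC -qrank_block_eq.
by rewrite -[0 as X in row_mx (col_mx _ _) X]col_mx0 -block_mxEh -block_mxEv.
Qed.

Lemma rank_conditionsP (R : realType) (p q a1 a2 m b1 b2 n : nat)
    (A11 : 'M[quaternion R]_(p, a1)) (A22 : 'M[quaternion R]_(p, a2))
    (A33 : 'M[quaternion R]_(p, m))
    (B11 : 'M[quaternion R]_(b1, q)) (B22 : 'M[quaternion R]_(b2, q))
    (B33 : 'M[quaternion R]_(n, q)) (T1 : 'M[quaternion R]_(p, q)) :
  (qrank (row_mx T1 (row_mx A11 (row_mx A22 A33)))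
      = qrank (row_mx A11 (row_mx A22 A33)) /\
    qrank (col_mx T1 (col_mx B11 (col_mx B22 B33)))
      = qrank (col_mx B11 (col_mx B22 B33)) /\
    qrank (col_mx (row_mx T1 (row_mx A11 A22))
                  (row_mx B33 (row_mx 0 0)))
      = (qrank (row_mx A11 A22) + qrank B33)%N /\
    qrank (col_mx (row_mx T1 (row_mx A11 A33))
                  (row_mx B22 (row_mx 0 0)))
      = (qrank (row_mx A11 A33) + qrank B22)%N /\
    qrank (col_mx (row_mx T1 (row_mx A33 A22))
                  (row_mx B11 (row_mx 0 0)))
      = (qrank (row_mx A33 A22) + qrank B11)%N /\
    qrank (col_mx (row_mx T1 A33)
          (col_mx (row_mx B11 0)
                  (row_mx B22 0)))
      = (qrank (col_mx B11 B22) + qrank A33)%N /\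
    qrank (col_mx (row_mx T1  (row_mx 0     (row_mx A11 (row_mx 0   A33))))
          (col_mx (row_mx 0   (row_mx (-T1) (row_mx 0   (row_mx A22 A33))))
          (col_mx (row_mx B22 (row_mx 0     (row_mx 0   (row_mx 0   0))))
          (col_mx (row_mx 0   (row_mx B11   (row_mx 0   (row_mx 0   0))))
                  (row_mx B33 (row_mx B33   (row_mx 0   (row_mx 0   0))))))))
      = (qrank (col_mx (row_mx B22 0) (col_mx (row_mx 0 B11) (row_mx B33 B33)))
         + qrank (col_mx (row_mx A11 (row_mx 0 A33))
                         (row_mx 0 (row_mx A22 A33))))%N /\
    qrank (col_mx (row_mx T1 A22)
          (col_mx (row_mx B11 0)
                  (row_mx B33 0)))
      = (qrank (col_mx B11 B33) + qrank A22)%N /\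
    qrank (col_mx (row_mx T1 A11)
          (col_mx (row_mx B33 0)
                  (row_mx B22 0)))
      = (qrank (col_mx B33 B22) + qrank A11)%N) <->
  block_conditions (@L_ R) (@R_ R) A11 A22 A33 B11 B22 B33 T1.
Proof.
rewrite block_reassoc qrank_cast [(qrank (col_mx (row_mx B22 _) _) + _)%N]addnC.
rewrite !row_mx0 qrank_row_eq qrank_col_eq !qrank_block_eq.
by rewrite !qrank_col_block_eq.
Qed.

Theorem corollary4p2 (R : realType) (p q a1 a2 m b1 b2 n : nat)
    (A11 : 'M[quaternion R]_(p, a1)) (A22 : 'M[quaternion R]_(p, a2))
    (A33 : 'M[quaternion R]_(p, m))
    (B11 : 'M[quaternion R]_(b1, q)) (B22 : 'M[quaternion R]_(b2, q))
    (B33 : 'M[quaternion R]_(n, q))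
    (T1 : 'M[quaternion R]_(p, q)) :
  let M1 := R_ A11 *m A22 in
  let N1 := B22 *m L_ B11 in
  let S1 := A22 *m L_ M1 in
  let C := R_ M1 *m R_ A11 in
  let C1 := C *m A33 in
  let C2 := R_ A11 *m A33 in
  let C3 := R_ A22 *m A33 in
  let C4 := A33 in
  let D := L_ B11 *m L_ N1 in
  let D1 := B33 in
  let D2 := B33 *m L_ B22 in
  let D3 := B33 *m L_ B11 in
  let D4 := B33 *m D in
  let E1 := C *m T1 in
  let E2 := R_ A11 *m T1 *m L_ B22 in
  let E3 := R_ A22 *m T1 *m L_ B11 in
  let E4 := T1 *m D in
  let C11 := row_mx (L_ C2) (L_ C4) in
  let D11 := col_mx (R_ D1) (R_ D3) in
  let C22 := L_ C1 in
  let D22 := R_ D2 in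
  let C33 := L_ C3 in
  let D33 := R_ D4 in
  let E11 := R_ C11 *m C22 in
  let E22 := R_ C11 *m C33 in
  let E33 := D22 *m L_ D11 in
  let E44 := D33 *m L_ D11 in
  let M := R_ E11 *m E22 in
  let N := E44 *m L_ E33 in
  let S := E22 *m L_ M in
  let F1 := C1^† *m E1 *m D1^† + L_ C1 *m C2^† *m E2 *m D2^† in
  let F2 := C3^† *m E3 *m D3^† + L_ C3 *m C4^† *m E4 *m D4^† in
  let F := F2 - F1 in
  let E := R_ C11 *m F *m L_ D11 in
  let solution (Y1 : 'M[quaternion R]_(a1, b1))
      (Y2 : 'M[quaternion R]_(a2, b2)) (Y3 : 'M[quaternion R]_(m, n)) :=
    A11 *m Y1 *m B11 + A22 *m Y2 *m B22 + A33 *m Y3 *m B33 = T1 in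
  let consistent := exists Y1 Y2 Y3, solution Y1 Y2 Y3 in
  let projection_conditions :=
    [/\ R_ C1 *m E1 = 0 /\ E1 *m L_ D1 = 0,
        R_ C2 *m E2 = 0 /\ E2 *m L_ D2 = 0,
        R_ C3 *m E3 = 0 /\ E3 *m L_ D3 = 0,
        R_ C4 *m E4 = 0 /\ E4 *m L_ D4 = 0 &
        R_ E22 *m E *m L_ E33 = 0] in
  let rank_conditions :=
    qrank (row_mx T1 (row_mx A11 (row_mx A22 A33)))
      = qrank (row_mx A11 (row_mx A22 A33)) /\
    qrank (col_mx T1 (col_mx B11 (col_mx B22 B33)))
      = qrank (col_mx B11 (col_mx B22 B33)) /\
    qrank (col_mx (row_mx T1 (row_mx A11 A22))
                  (row_mx B33 (row_mx 0 0)))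
      = (qrank (row_mx A11 A22) + qrank B33)%N /\
    qrank (col_mx (row_mx T1 (row_mx A11 A33))
                  (row_mx B22 (row_mx 0 0)))
      = (qrank (row_mx A11 A33) + qrank B22)%N /\
    qrank (col_mx (row_mx T1 (row_mx A33 A22))
                  (row_mx B11 (row_mx 0 0)))
      = (qrank (row_mx A33 A22) + qrank B11)%N /\
    qrank (col_mx (row_mx T1 A33)
          (col_mx (row_mx B11 0)
                  (row_mx B22 0)))
      = (qrank (col_mx B11 B22) + qrank A33)%N /\
    qrank (col_mx (row_mx T1  (row_mx 0     (row_mx A11 (row_mx 0   A33))))
          (col_mx (row_mx 0   (row_mx (-T1) (row_mx 0   (row_mx A22 A33))))
          (col_mx (row_mx B22 (row_mx 0     (row_mx 0   (row_mx 0   0))))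
          (col_mx (row_mx 0   (row_mx B11   (row_mx 0   (row_mx 0   0))))
                  (row_mx B33 (row_mx B33   (row_mx 0   (row_mx 0   0))))))))
      = (qrank (col_mx (row_mx B22 0) (col_mx (row_mx 0 B11) (row_mx B33 B33)))
         + qrank (col_mx (row_mx A11 (row_mx 0 A33))
                         (row_mx 0 (row_mx A22 A33))))%N /\
    qrank (col_mx (row_mx T1 A22)
          (col_mx (row_mx B11 0)
                  (row_mx B33 0)))
      = (qrank (col_mx B11 B33) + qrank A22)%N /\
    qrank (col_mx (row_mx T1 A11)
          (col_mx (row_mx B33 0)
                  (row_mx B22 0)))
      = (qrank (col_mx B33 B22) + qrank A11)%N in
  (* Y3 and Y3' are the values of the two expressions for the third unknown *)
  let general_solution
      (U4 : 'M[quaternion R]_(a2, b2)) (U5 U6 : 'M[quaternion R]_(a1, b1))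
      (U7 U8 : 'M[quaternion R]_(a2, b2))
      (U11 : 'M[quaternion R]_(m, n + n)) (U12 : 'M[quaternion R]_(m + m, n))
      (U21 : 'M[quaternion R]_(m, n + n))
      (U31 U32 U33 U41 U42 : 'M[quaternion R]_(m, n))
      (Y1 : 'M[quaternion R]_(a1, b1)) (Y2 : 'M[quaternion R]_(a2, b2))
      (Y3 Y3' : 'M[quaternion R]_(m, n)) :=
    let V3 := E11^† *m F *m E33^†
              - E11^† *m E22 *m M^† *m F *m E33^†
              - E11^† *m S *m E22^† *m F *m N^† *m E44 *m E33^†
              - E11^† *m S *m U31 *m R_ N *m E44 *m E33^†
              + L_ E11 *m U32 + U33 *m R_ E33 in
    let W3 := M^† *m F *m E44^† + S^† *m S *m E22^† *m F *m N^†
              + L_ M *m L_ S *m U41 + L_ M *m U31 *m R_ N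
              - U42 *m R_ E44 in
    let V1 := row_mx 1%:M 0 *m
              (C11^† *m (F - C22 *m V3 *m D22 - C33 *m W3 *m D33)
               - C11^† *m U11 *m D11 + L_ C11 *m U12) in
    let W1 := row_mx 0 1%:M *m
              (C11^† *m (F - C22 *m V3 *m D22 - C33 *m W3 *m D33)
               - C11^† *m U11 *m D11 + L_ C11 *m U12) in
    let W2 := (R_ C11 *m (F - C22 *m V3 *m D22 - C33 *m W3 *m D33) *m D11^†
               + C11 *m C11^† *m U11 + U21 *m R_ D11)
              *m col_mx 0 1%:M in
    let V2 := (R_ C11 *m (F - C22 *m V3 *m D22 - C33 *m W3 *m D33) *m D11^†
               + C11 *m C11^† *m U11 + U21 *m R_ D11)
              *m col_mx 1%:M 0 in
    let T := T1 - A33 *m Y3 *m B33 in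
    [/\ Y1 = A11^† *m T *m B11^†
             - A11^† *m A22 *m M1^† *m T *m B11^†
             - A11^† *m S1 *m A22^† *m T *m N1^† *m B22 *m B11^†
             - A11^† *m S1 *m U4 *m R_ N1 *m B22 *m B11^†
             + L_ A11 *m U5 + U6 *m R_ B11,
        Y2 = M1^† *m T *m B22^† + S1^† *m S1 *m A22^† *m T *m N1^†
             + L_ M1 *m L_ S1 *m U7 + U8 *m R_ B22
             + L_ M1 *m U4 *m R_ N1,
        Y3 = F1 + L_ C2 *m V1 + V2 *m R_ D1 + L_ C1 *m V3 *m R_ D2 &
        Y3' = F2 - L_ C4 *m W1 - W2 *m R_ D3 - L_ C3 *m W3 *m R_ D4] in
  (consistent <-> projection_conditions) /\
  (projection_conditions <-> rank_conditions) /\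
  (consistent ->
    (forall U4 U5 U6 U7 U8 U11 U12 U21 U31 U32 U33 U41 U42 Y1 Y2 Y3 Y3',
      general_solution U4 U5 U6 U7 U8 U11 U12 U21 U31 U32 U33 U41 U42
        Y1 Y2 Y3 Y3' ->
      Y3 = Y3' /\ solution Y1 Y2 Y3) /\
    (forall Y1 Y2 Y3, solution Y1 Y2 Y3 ->
      exists U4 U5 U6 U7 U8 U11 U12 U21 U31 U32 U33 U41 U42,
        general_solution U4 U5 U6 U7 U8 U11 U12 U21 U31 U32 U33 U41 U42
          Y1 Y2 Y3 Y3)).
Proof.
move=> M1 N1 S1 C C1 C2 C3 C4 D D1 D2 D3 D4 E1 E2 E3 E4 C11 D11 C22 D22 C33 D33.
move=> E11 E22 E33 E44 M N S F1 F2 F E sol consistent proj_conditions.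
move=> rank_conditions gen_sol.
have [consistentP projectionP generalP] := three_term_equation
  (@mpinvK R) (fun _ _ _ => erefl) (fun _ _ _ => erefl)
  (@mpinv_absorb_R R) (@L_mpinv_absorb R)
  (M1 := M1) erefl (N1 := N1) erefl (C := C) erefl (D := D) erefl
  (C1 := C1) erefl (C2 := C2) erefl (C3 := C3) erefl
  (D2 := D2) erefl (D3 := D3) erefl (D4 := D4) erefl
  (E1 := E1) erefl (E2 := E2) erefl (E3 := E3) erefl (E4 := E4) erefl
  (S1 := S1) erefl (C11 := C11) erefl (D11 := D11) erefl
  (E11 := E11) erefl (E22 := E22) erefl (E33 := E33) erefl (E44 := E44) erefl
  (M := M) erefl (N := N) erefl (S := S) erefl
  (F1 := F1) erefl (F2 := F2) erefl (F := F) erefl (E := E) erefl.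
split; first exact: consistentP.
split; last exact: generalP.
apply: (iff_trans projectionP); apply: iff_sym.
exact: (@rank_conditionsP R _ _ _ _ _ _ _ _ A11 A22 A33 B11 B22 B33 T1).
Qed.
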